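(* Let $X$ and $Y$ be Riemann surfaces holomorphically covered by the unit disc, with $\ell_1(X) < \ell_1(Y)$, where the $\ell_1$-invariants are taken with respect to the canonical metrics. If $f\colon X\to Y$ is a holomorphic map, then $f$ is not injective on homotopy, i.e. the induced homomorphism $f_*\colon \pi_1(X)\to\pi_1(Y)$ is not injective. In particular, $f$ is not a homotopy equivalence.
   Context: $\Delta=\{z\in\mathbb{C}\colon |z|<1\}$ carries the Poincaré metric $4(1-|z|^2)^{-2}\,dz\,d\bar z$ (curvature $-1$). If $M$ is a (connected) Riemann surface with a holomorphic covering map $\pi\colon\Delta\to M$, the canonical metric of $M$ is the unique Riemannian (Hermitian) metric on $M$ for which $\pi$ is a local isometry; $M$ is regarded as a metric space with the associated Riemannian distance. For a metric space $(X,\rho)$ and a continuous curve $\alpha\colon[a,b]\to X$, the length is $L(\alpha)=\sup \sum_{k=1}^N\rho(\alpha(t_{k-1}),\alpha(t_k))$, the supremum being over all partitions $a=t_0<t_1<\dots<t_N=b$; $\alpha$ is rectifiable if $L(\alpha)<\infty$. The $\ell_1$-invariant is $$\ell_1(X)=\inf\{L(\alpha)\colon \alpha \text{ a non-contractible rectifiable loop in } X\},\qquad \inf\varnothing=+\infty,$$ where a loop is non-contractible if it is not freely homotopic to a constant loop. *)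

(* Defs.v *)
From HB Require Import structures.
From mathcomp Require Import all_boot all_order all_algebra.
From mathcomp Require Import generic_quotient.
From mathcomp Require Import all_classical all_reals all_analysis.
From mathcomp Require Import complex.

Set Implicit Arguments.
Unset Strict Implicit.
Unset Printing Implicit Defensive.

Import Order.TTheory GRing.Theory Num.Theory.
Import numFieldNormedType.Exports.

Local Open Scope classical_set_scope.
Local Open Scope ring_scope.
Local Open Scope complex_scope.
Local Open Scope quotient_scope.

(* R[i] itself carries no topology; as a normed module over the numFieldType
   R[i], the regular module R[i]^o does, and for functions between two copies
   of it [derivable f z 1] and [derive1 f] are complex differentiability and the
   complex derivative. *)
Notation Cplx R := (R[i])%type^o.

Section Complex.
Context {R : realType}.
Implicit Types (z v : Cplx R) (U : set (Cplx R)).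

Definition cmod z : R := ComplexField.Normc.normc (z : R[i]).

Definition unit_disc : set (Cplx R) := [set z | cmod z < 1].

Definition holomorphic_on U (h : Cplx R -> Cplx R) : Prop :=
  forall z, U z -> derivable h z 1.

(* Real directional derivatives; along 1 and 'i they are the partial
   derivatives with respect to the real and imaginary part. *)
Definition along (h : Cplx R -> R) z v : R -> R := fun t => h (z + t%:C * v).

Definition partial v (h : Cplx R -> R) : Cplx R -> R :=
  fun z => derive1 (along h z v) 0.

Fixpoint Ck (k : nat) U (h : Cplx R -> R) : Prop :=
  {in U, continuous h} /\
  if k is j.+1 then
    [/\ forall z, U z -> derivable (along h z 1) 0 1 /\
                         derivable (along h z 'i) 0 1,
        Ck j U (partial 1 h) & Ck j U (partial 'i h)]
  else True.

Definition smooth_on U (h : Cplx R -> R) : Prop := forall k, Ck k U h.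

End Complex.

Section Homotopy.
Context {R : realType}.

Definition homotopy_on (S T : topologicalType) (A : set S) (f g : S -> T)
    (H : S * R -> T) : Prop :=
  [/\ {within A `*` `[0, 1], continuous H},
      forall x, A x -> H (x, 0) = f x
    & forall x, A x -> H (x, 1) = g x].

Definition homotopic (S T : topologicalType) (f g : S -> T) : Prop :=
  exists H, homotopy_on setT f g H.

Definition homotopy_equivalence (S T : topologicalType) (f : S -> T) : Prop :=
  continuous f /\ exists g : T -> S,
    [/\ continuous g, homotopic (g \o f) id & homotopic (f \o g) id].

Definition is_loop (T : topologicalType) (a b : R) (alpha : R -> T) : Prop :=
  {within `[a, b], continuous alpha} /\ alpha a = alpha b.

Definition contractible_loop (T : topologicalType) (a b : R) (alpha : R -> T) :
    Prop :=
  exists (p : T) (H : R * R -> T), homotopy_on `[a, b] alpha (cst p) H /\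
    forall s, 0 <= s <= 1 -> H (a, s) = H (b, s).

End Homotopy.

(* rho is a distance with values in \bar R, and continuity refers to the topology
   of T; for the Riemannian distance of a Riemann surface it is the topology
   of the distance. *)
Section MetricLength.
Context {R : realType} {T : topologicalType} (rho : T -> T -> \bar R).
Local Open Scope ereal_scope.

Definition curve_length (a b : R) (alpha : R -> T) : \bar R :=
  ereal_sup [set \sum_(k < size s)
                   rho (alpha (nth b (a :: s) k)) (alpha (nth b (a :: s) k.+1))
            | s in [set s : seq R | itv_partition a b s]].

Definition ell1 : \bar R :=
  ereal_inf [set l | exists a b alpha,
    [/\ (a < b)%R, is_loop a b alpha, ~ contractible_loop a b alpha,
        curve_length a b alpha < +oo & l = curve_length a b alpha]].

End MetricLength.

Section RiemannSurfaces.
Context {R : realType}.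
Local Notation C := (Cplx R).

(* [chart_map] and [chart_inv] are total functions, relevant only on
   [chart_dom] and on its image. *)
Record chart (M : topologicalType) := Chart {
  chart_dom : set M;
  chart_map :> M -> C;
  chart_inv : C -> M;
  chart_dom_open : open chart_dom;
  chart_img_open : open (chart_map @` chart_dom);
  chart_map_continuous : {within chart_dom, continuous chart_map};
  chart_inv_continuous : {within chart_map @` chart_dom, continuous chart_inv};
  chart_mapK : forall p, chart_dom p -> chart_inv (chart_map p) = p
}.

Definition chart_img M (phi : chart M) : set C := phi @` chart_dom phi.

Definition transition M (phi psi : chart M) : C -> C := psi \o chart_inv phi.

Record riemann_surface := RiemannSurface {
  surface_space :> topologicalType;
  surface_hausdorff : hausdorff_space surface_space;
  surface_connected : connected [set: surface_space];
  atlas : set (chart surface_space);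
  atlas_cover : forall p, exists2 phi, atlas phi & chart_dom phi p;
  atlas_compat : forall phi psi, atlas phi -> atlas psi ->
    holomorphic_on (phi @` (chart_dom phi `&` chart_dom psi))
                   (transition phi psi)
}.

Definition chart_at (M : riemann_surface) (p : M) : chart M :=
  sval (cid2 (@atlas_cover M p)).

Record holomorphic_map (X Y : riemann_surface) := HolomorphicMap {
  hol_fun :> X -> Y;
  hol_continuous : continuous hol_fun;
  hol_charts : forall (phi : chart X) (psi : chart Y),
    atlas phi -> atlas psi ->
    holomorphic_on (phi @` (chart_dom phi `&` hol_fun @^-1` chart_dom psi))
                   (psi \o hol_fun \o chart_inv phi)
}.

(* In the chart phi the metric is [hcoef phi z] dz dzbar, so the length of a
   tangent vector v at z is sqrt (hcoef phi z) * |v|. *)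
Record hermitian_metric (M : riemann_surface) := HermitianMetric {
  hcoef : chart M -> C -> R;
  hcoef_gt0 : forall phi z, atlas phi -> chart_img phi z -> 0 < hcoef phi z;
  hcoef_smooth : forall phi, atlas phi ->
    smooth_on (chart_img phi) (hcoef phi);
  hcoef_compat : forall phi psi p, atlas phi -> atlas psi ->
    chart_dom phi p -> chart_dom psi p ->
    hcoef phi (phi p) =
      hcoef psi (psi p) * cmod (derive1 (transition phi psi) (phi p)) ^+ 2
}.

Section Distance.
Context {M : riemann_surface}.

Definition C1_on (O : set R) (gamma : R -> M) : Prop :=
  forall t, O t -> {for t, continuous gamma} /\
    forall phi, atlas phi -> chart_dom phi (gamma t) ->
      let x := fun s => complex.Re (phi (gamma s)) in
      let y := fun s => complex.Im (phi (gamma s)) in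
      [/\ derivable x t 1, derivable y t 1,
          {for t, continuous (derive1 x)} & {for t, continuous (derive1 y)}].

(* C^1 on a compact interval: restriction of a C^1 curve defined on an open
   neighbourhood of it. *)
Definition piecewise_C1 (a b : R) (gamma : R -> M) : Prop :=
  {within `[a, b], continuous gamma} /\
  exists2 s, itv_partition a b s & forall k, (k < size s)%N ->
    let I := `[nth b (a :: s) k, nth b (a :: s) k.+1] in
    exists (O : set R) (delta : R -> M),
      [/\ open O, [set` I] `<=` O, C1_on O delta & {in I, delta =1 gamma}].

(* The value does not depend on the chart around gamma t. *)
Definition speed (g : hermitian_metric M) (gamma : R -> M) (t : R) : R :=
  let phi := chart_at (gamma t) in
  let x := fun s => complex.Re (phi (gamma s)) in
  let y := fun s => complex.Im (phi (gamma s)) in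
  Num.sqrt (hcoef g phi (phi (gamma t))) *
  Num.sqrt (derive1 x t ^+ 2 + derive1 y t ^+ 2).

Definition riemannian_length (g : hermitian_metric M) (a b : R)
    (gamma : R -> M) : \bar R :=
  (\int[lebesgue_measure]_(t in `[a, b]) (speed g gamma t)%:E)%E.

Definition riemannian_distance (g : hermitian_metric M) (p q : M) : \bar R :=
  ereal_inf [set riemannian_length g 0 1 gamma | gamma in
    [set gamma | [/\ piecewise_C1 0 1 gamma, gamma 0 = p & gamma 1 = q]]].

End Distance.

Section DiscCovering.
Context {M : riemann_surface}.
Implicit Type pi : C -> M.

(* Maps from the unit disc are represented by functions on the plane, all
   conditions being restricted to the disc. *)
Definition holomorphic_from_disc pi : Prop :=
  {within unit_disc, continuous pi} /\
  forall phi, atlas phi ->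
    holomorphic_on (unit_disc `&` pi @^-1` chart_dom phi) (phi \o pi).

Definition evenly_covered pi (V : set M) : Prop :=
  exists (I : Type) (U : I -> set C) (sigma : I -> M -> C),
    [/\ forall i, open (U i), trivIset setT U,
        \bigcup_i U i = unit_disc `&` pi @^-1` V
      & forall i, [/\ pi @` U i = V, {within V, continuous (sigma i)}
                    & forall z, U i z -> sigma i (pi z) = z]].

Definition disc_covering pi : Prop :=
  [/\ {within unit_disc, continuous pi}, pi @` unit_disc = setT
    & forall p, exists2 V, open_nbhs p V & evenly_covered pi V].

Definition holomorphic_disc_covering pi : Prop :=
  holomorphic_from_disc pi /\ disc_covering pi.

(* 4 (1 - |z|^2)^-2 dz dzbar *)
Definition poincare_coef (z : C) : R := 4 * (1 - cmod z ^+ 2) ^- 2.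

(* pi pulls the metric back to the Poincare metric; being conformal, both are
   determined by their coefficients. If pi is a holomorphic covering, exactly
   one metric g satisfies this: the canonical metric of M. *)
Definition disc_local_isometry pi (g : hermitian_metric M) : Prop :=
  forall z phi, unit_disc z -> atlas phi -> chart_dom phi (pi z) ->
    poincare_coef z =
      hcoef g phi (phi (pi z)) * cmod (derive1 (phi \o pi) z) ^+ 2.

End DiscCovering.
End RiemannSurfaces.

Arguments riemann_surface R : clear implicits.
Arguments chart_map_continuous {R M} phi : rename.
Arguments chart_inv_continuous {R M} phi : rename.
Arguments hol_continuous {R X Y} f : rename.

Section HomotopyRelations.
Context {R : realType}.

Lemma within_comp (S T U : topologicalType) (A : set S) (B : set T)
    (h : S -> T) (f : T -> U) :
  {within A, continuous h} -> {within B, continuous f} ->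
  (forall x, A x -> B (h x)) -> {within A, continuous (f \o h)}.
Proof.
move=> /subspace_continuousP hc /subspace_continuousP fc AB.
apply/subspace_continuousP => x Ax.
apply: cvg_comp (fc _ (AB _ Ax)) => W /=; rewrite /within /= => nW.
have : nbhs x (fun y => A y -> B (h y) -> W (h y)) := hc _ Ax _ nW.
move=> hW; rewrite -[_ (_ @^-1` _)]/(nbhs x (fun y => A y -> W (h y))).
by apply: filterS hW => y yW Ay; exact: yW Ay (AB _ Ay).
Qed.

Lemma continuous_reparam (S : topologicalType) (u : R -> R) :
  continuous u -> continuous (fun z : S * R => (z.1, u z.2)).
Proof.
move=> uc z; apply: (@cvg_pair _ _ _ (nbhs z) (nbhs z.1) (nbhs (u z.2))).
  exact: cvg_fst.
by apply: continuous_comp; [exact: cvg_snd|exact: uc].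
Qed.

Lemma closed_setX (S T : topologicalType) (A : set S) (B : set T) :
  closed A -> closed B -> closed (A `*` B).
Proof.
move=> clA clB; have -> : A `*` B = (fst @^-1` A) `&` (snd @^-1` B) by [].
by apply: closedI; apply: preimage_closed => // z _;
  [exact: cvg_fst|exact: cvg_snd].
Qed.

Context {S T : topologicalType} (A : set S).
Implicit Types (f g h : S -> T) (H : S * R -> T).

Definition cst_homotopy f : S * R -> T := f \o fst.

Definition rev_homotopy H : S * R -> T := fun z => H (z.1, 1 - z.2).

Definition cat_homotopy H K : S * R -> T := fun z =>
  if z.2 <= 2^-1 then H (z.1, 2 * z.2) else K (z.1, 2 * z.2 - 1).

Lemma cst_homotopyP f : {within A, continuous f} ->
  homotopy_on A f f (cst_homotopy f).
Proof.
move=> fc; split => //; apply: (within_comp _ fc) => [|x []//].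
by apply: continuous_subspaceT => x; exact: cvg_fst.
Qed.

Lemma rev_homotopyP f g H : homotopy_on A f g H ->
  homotopy_on A g f (rev_homotopy H).
Proof.
move=> [Hc H0 H1]; split; last 2 first.
- by move=> x Ax; rewrite /rev_homotopy /= subr0 H1.
- by move=> x Ax; rewrite /rev_homotopy /= subrr H0.
apply: (within_comp (h := fun z : S * R => (z.1, 1 - z.2)) _ Hc).
- apply/continuous_subspaceT/(@continuous_reparam _ (fun s => 1 - s)) => s.
  by apply: cvgB; [exact: cvg_cst|exact: cvg_id].
- move=> [x s] [/= Ax]; rewrite !in_itv/= => /andP[s0 s1]; split => //=.
  by rewrite subr_ge0 s1 lerBlDr lerDl.
Qed.

Lemma cat_homotopyP f g h H K : closed A ->
  homotopy_on A f g H -> homotopy_on A g h K ->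
  homotopy_on A f h (cat_homotopy H K).
Proof.
move=> clA [Hc H0 H1] [Kc K0 K1].
have half01 : (2^-1 : R) <= 1 by rewrite invf_le1// ler1n.
split; last 2 first.
- by move=> x Ax; rewrite /cat_homotopy /= mulr0 invr_ge0 ler0n H0.
- move=> x Ax; rewrite /cat_homotopy /= leNgt invf_lt1// ltr1n /= mulr1.
  by rewrite -[2]/(1 + 1) addrK K1.
have -> : A `*` `[0, 1] = A `*` `[0, 2^-1] `|` A `*` `[2^-1, (1 : R)].
  apply/seteqP; split => -[x s] /=; rewrite !in_itv/=.
    move=> [Ax /andP[-> ->]]; rewrite andbT.
    by case: (leP s 2^-1) => [hs|/ltW hs]; [left|right].
  move=> [[Ax /andP[-> /le_trans->//]]|[Ax /andP[hs ->]]]; split => //.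
  by rewrite andbT; apply: le_trans hs; rewrite invr_ge0.
apply: withinU_continuous; try by apply: closed_setX => //; exact: itv_closed.
- apply: (@subspace_eq_continuous _ _ _
    (fun z : S * R => H (z.1, 2 * z.2) : T)).
    by move=> [x s] /set_mem[/= _]; rewrite in_itv/= /from_subspace /cat_homotopy/=
      => /andP[_ ->].
  apply: (within_comp (h := fun z : S * R => (z.1, 2 * z.2)) _ Hc).
    apply/continuous_subspaceT/(@continuous_reparam _ (fun s => 2 * s)) => s.
    by apply: cvgM; [exact: cvg_cst|exact: cvg_id].
  move=> [x s] [/= Ax]; rewrite !in_itv/= => /andP[s0 s1]; split => //=.
  by rewrite mulr_ge0//= mulrC -ler_pdivlMr// div1r.
- apply: (@subspace_eq_continuous _ _ _
    (fun z : S * R => K (z.1, 2 * z.2 - 1) : T)).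
    move=> [x s] /set_mem[/= Ax]; rewrite in_itv/= /from_subspace /cat_homotopy/=
      => /andP[hs _].
    case: ifPn => // sh; have -> : s = 2^-1 by apply/eqP; rewrite eq_le sh hs.
    by rewrite divff// subrr K0// H1.
  apply: (within_comp (h := fun z : S * R => (z.1, 2 * z.2 - 1)) _ Kc).
    apply/continuous_subspaceT/(@continuous_reparam _ (fun s => 2 * s - 1)) => s.
    apply: cvgB; last exact: cvg_cst.
    by apply: cvgM; [exact: cvg_cst|exact: cvg_id].
  move=> [x s] [/= Ax]; rewrite !in_itv/= => /andP[s0 s1]; split => //=.
  rewrite subr_ge0 lerBlDr -[1 + 1]/2 [2 * s]mulrC.
  by rewrite -ler_pdivrMr// div1r s0 ler_piMl.
Qed.

End HomotopyRelations.

Section FundamentalGroup.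
Context {R : realType}.

(* Loops are total functions on R, relevant only on [0, 1]; two of them that agree
   there are path homotopic, so they define the same element of pi1. *)
Record loop (T : topologicalType) (x : T) := Loop {
  loop_fun :> R -> T;
  loop_continuous : {within `[0, 1], continuous loop_fun};
  loop0 : loop_fun 0 = x;
  loop1 : loop_fun 1 = x
}.

HB.instance Definition _ (T : topologicalType) (x : T) :=
  gen_eqMixin (loop x).
HB.instance Definition _ (T : topologicalType) (x : T) :=
  gen_choiceMixin (loop x).

Definition path_homotopic (T : topologicalType) (x : T) (a b : loop x) : Prop :=
  exists H : R * R -> T, homotopy_on `[(0 : R), 1] a b H /\
    forall s, 0 <= s <= 1 -> H (0, s) = x /\ H (1, s) = x.

Section Quotient.
Context {T : topologicalType} (x : T).
Implicit Types a b c : loop x.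

Lemma path_homotopic_refl a : path_homotopic a a.
Proof.
exists (cst_homotopy a); split; first exact/cst_homotopyP/loop_continuous.
by move=> s _; rewrite /cst_homotopy /= loop0 loop1.
Qed.

Lemma path_homotopic_sym a b : path_homotopic a b -> path_homotopic b a.
Proof.
move=> [H [hH He]]; exists (rev_homotopy H); split.
  exact: rev_homotopyP.
move=> s /andP[s0 s1]; apply: He.
by rewrite /= subr_ge0 s1 lerBlDr lerDl.
Qed.

Lemma path_homotopic_trans a b c :
  path_homotopic a b -> path_homotopic b c -> path_homotopic a c.
Proof.
move=> [H [hH He]] [K [hK Ke]]; exists (cat_homotopy H K); split.
  by apply: cat_homotopyP hH hK; exact: itv_closed.
move=> s /andP[s0 s1]; rewrite /cat_homotopy /=; case: (leP s 2^-1) => hs.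
  by apply: He; rewrite mulr_ge0//= mulrC -ler_pdivlMr// div1r.
apply: Ke; rewrite subr_ge0 lerBlDr -[1 + 1]/2 [2 * s]mulrC.
by rewrite -ler_pdivrMr// div1r ltW//= ler_piMl.
Qed.

Definition path_homotopicb : rel (loop x) := fun a b => `[< path_homotopic a b >].

Lemma path_homotopicb_refl : reflexive path_homotopicb.
Proof. by move=> a; apply/asboolP; exact: path_homotopic_refl. Qed.

Lemma path_homotopicb_sym : symmetric path_homotopicb.
Proof.
by move=> a b; apply/asboolP/asboolP; exact: path_homotopic_sym.
Qed.

Lemma path_homotopicb_trans : transitive path_homotopicb.
Proof.
move=> b a c /asboolP ab /asboolP bc.
by apply/asboolP; exact: path_homotopic_trans ab bc.
Qed.

Canonical path_homotopic_equiv := EquivRel path_homotopicb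
  path_homotopicb_refl path_homotopicb_sym path_homotopicb_trans.

Definition pi1 := {eq_quot path_homotopic_equiv}.

Lemma pi1P a b : (\pi_pi1 a = \pi_pi1 b) <-> path_homotopic a b.
Proof.
split=> [/eqP|h]; first by rewrite eqmodE => /asboolP.
by apply/eqP; rewrite eqmodE; exact/asboolP.
Qed.

End Quotient.

(* The elements of the group with their induced map, which is all that
   injectivity of the induced homomorphism depends on. *)
Section Induced.
Context {S T : topologicalType} (f : S -> T) (fc : continuous f) (x : S).

Lemma loop_comp_continuous (a : loop x) :
  {within `[(0 : R), 1], continuous (f \o a)}.
Proof.
apply: (@within_comp _ _ _ _ setT) => //; first exact: loop_continuous.
exact: continuous_subspaceT.
Qed.

Lemma loop_comp0 (a : loop x) : f (a (0 : R)) = f x.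
Proof. by rewrite loop0. Qed.

Lemma loop_comp1 (a : loop x) : f (a (1 : R)) = f x.
Proof. by rewrite loop1. Qed.

Definition loop_comp (a : loop x) : loop (f x) :=
  @Loop T (f x) (f \o a) (@loop_comp_continuous a) (loop_comp0 a)
    (loop_comp1 a).

Definition pi1_map (c : pi1 x) : pi1 (f x) :=
  \pi_(pi1 (f x)) (loop_comp (repr c)).

Lemma pi1_mapE (a : loop x) :
  pi1_map (\pi_(pi1 x) a) = \pi_(pi1 (f x)) (loop_comp a).
Proof.
have /pi1P[H [[Hc H0 H1] He]] :
  \pi_(pi1 x) (repr (\pi_(pi1 x) a)) = \pi_(pi1 x) a by rewrite reprK.
apply/pi1P; exists (f \o H); split; last by move=> s /He[/= -> ->].
split => [|t /H0/= ->|t /H1/= ->]//.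
apply: (@within_comp _ _ _ _ setT) => //.
exact: continuous_subspaceT.
Qed.

End Induced.
End FundamentalGroup.

Arguments pi1 R {T} x.
Arguments pi1_map R {S T f} fc x c.

(* Main.v *)
Require Import Defs.
From mathcomp Require Import all_boot all_order all_algebra.
From mathcomp Require Import all_classical all_reals all_analysis.
From mathcomp Require Import complex.
From mathcomp Require Import ring lra.

Set Implicit Arguments.
Unset Strict Implicit.
Unset Printing Implicit Defensive.

Import Order.TTheory GRing.Theory Num.Theory.
Import numFieldNormedType.Exports.

Local Open Scope classical_set_scope.
Local Open Scope ring_scope.
Local Open Scope complex_scope.

(** A loop [alpha] of [X] that is not contractible and is shorter than
    [ell1 Y] exists because [ell1 X < ell1 Y]. Holomorphic maps do not increase
    canonical distances, so [f \o alpha] is shorter than [ell1 Y] as well, hence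
    contractible. Joined to an arbitrary base point, [alpha] becomes a
    nontrivial element of the kernel of the induced map
    ([pi1_map_not_injective]); and if [f] had a homotopy inverse [g], then
    [alpha] would be freely homotopic to the contractible loop [g \o f \o alpha]
    ([homotopy_equivalence_contractible]).

    Distances decrease ([riemannian_distance_contraction]) because speeds do:
    [f \o piX] lifts through [piY] to a map [F] of the disc into itself
    ([lift_disc], along the rays from the centre), [F] is holomorphic since
    [piY] has a nonvanishing derivative, and the Schwarz-Pick inequality for [F]
    reads, through the two local isometries, as [metric_contraction].

    Holomorphic means complex differentiable at every point, without continuity
    of the derivative, so the function theory starts from Goursat's bisection
    ([goursat]). It is applied in polar coordinates and with primitives instead
    of integrals: a function holomorphic on an annulus takes, on any two of its
    circles, a common value of the real part ([circle_mean]). For [k z / z] with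
    [k 0 = 0], letting one circle shrink to [0] and the other one grow, this
    yields the sharp Cauchy estimate for [k' 0] ([cauchy_estimate]). The estimate
    has two consequences: the Schwarz-Pick inequality ([schwarz_pick]), and the
    continuity of complex derivatives ([derive1_continuous]), which is what makes
    the image of a piecewise C^1 curve piecewise C^1 ([piecewise_C1_comp]). *)

(** * Complex derivatives through slopes *)

Section PointwiseContinuity.
Context {T : topologicalType} {K : numFieldType}.
Implicit Types (f g : T -> K^o) (x : T).

Lemma cont_id x : {for x, continuous (fun y : T => y)}.
Proof. exact: cvg_id. Qed.

Lemma cont_cst (U : topologicalType) (c : U) x : {for x, continuous (fun=> c)}.
Proof. exact: cvg_cst. Qed.

Lemma contD f g x : {for x, continuous f} -> {for x, continuous g} ->
  {for x, continuous (fun y => f y + g y : K^o)}.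
Proof. by move=> fc gc; apply: cvgD. Qed.

Lemma contN f x : {for x, continuous f} -> {for x, continuous (fun y => - f y : K^o)}.
Proof. by move=> fc; apply: cvgN. Qed.

Lemma contB f g x : {for x, continuous f} -> {for x, continuous g} ->
  {for x, continuous (fun y => f y - g y : K^o)}.
Proof. by move=> fc gc; apply: cvgB. Qed.

Lemma contM f g x : {for x, continuous f} -> {for x, continuous g} ->
  {for x, continuous (fun y => f y * g y : K^o)}.
Proof. by move=> fc gc; apply: cvgM. Qed.

Lemma contV f x : f x != 0 -> {for x, continuous f} ->
  {for x, continuous (fun y => (f y)^-1 : K^o)}.
Proof. by move=> fx fc; apply: cvgV. Qed.

Lemma cont_pair (U V : topologicalType) (f : T -> U) (g : T -> V) x :
  {for x, continuous f} -> {for x, continuous g} ->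
  {for x, continuous (fun y : T => (f y, g y) : U * V)}.
Proof.
move=> fc gc.
exact: (@cvg_pair _ _ _ (nbhs x) (nbhs (f x)) (nbhs (g x)) _ _ _ f g fc gc).
Qed.

Lemma cont_near (U : topologicalType) (f g : T -> U) x :
  {near x, f =1 g} -> {for x, continuous f} -> {for x, continuous g}.
Proof.
move=> fg fc; have fgx : f x = g x := nbhs_singleton fg.
rewrite /prop_for /continuous_at -fgx.
by apply: cvg_trans fc; exact: near_eq_cvg.
Qed.

End PointwiseContinuity.

Section Caratheodory.
Context {K : numFieldType}.
Implicit Types (f g C : K^o -> K^o) (z w d : K^o).

(** Caratheodory's form of differentiability: the slope extends continuously to
    the point. Sum, product and chain rule become identities between slopes, for
    real and complex functions alike. *)
Definition has_deriv f z d : Prop :=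
  exists C, [/\ {for z, continuous C}, C z = d &
    forall w, f w - f z = (w - z) * C w].

Lemma has_deriv_is_derive f z d : has_deriv f z d -> is_derive z 1 f d.
Proof.
move=> [C [Cc Cz fE]].
have cv : h^-1 *: ((f \o shift z) (h *: (1 : K^o)) - f z) @[h --> (0 : K^o)^'] --> d.
  have -> : d = C (0 + z) by rewrite add0r.
  apply: (@cvg_trans _ ((fun h : K^o => C (h + z)) @ (0 : K^o)^')).
    apply: near_eq_cvg; near=> h.
    rewrite /= fE addrK /GRing.scale/= mulr1 mulrA mulVf ?mul1r//.
    by near: h; exact: nbhs_dnbhs_neq.
  have Sc : {for 0, continuous (C \o (fun h : K^o => h + z))}.
    apply: (@continuous_comp K^o K^o K^o (fun h : K^o => h + z) C 0); last by rewrite add0r.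
    by apply: contD; [exact: cont_id|exact: cont_cst].
  exact: cvg_trans (cvg_app _ (@cvg_within _ _ _ _)) Sc.
by apply: DeriveDef; [apply/cvg_ex; exists d|exact: cvg_lim].
Unshelve. all: by end_near. Qed.

Lemma is_derive_has_deriv f z d : is_derive z 1 f d -> has_deriv f z d.
Proof.
move=> [df dE]; exists (fun w => if w == z then d else (f w - f z) / (w - z)).
split=> [||w]; last 2 first.
- by rewrite eqxx.
- case: eqP => [->|/eqP wz]; first by rewrite !subrr mul0r.
  by rewrite mulrC divfK// subr_eq0.
have cv : h^-1 *: ((f \o shift z) (h *: (1 : K^o)) - f z) @[h --> (0 : K^o)^'] --> d.
  by rewrite -dE; exact: df.
rewrite /prop_for /continuous_at eqxx.
apply/(@cvgrPdist_lt K K^o K^o (nbhs z) _) => e e0.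
move/cvgrPdist_lt : cv => /(_ e e0).
rewrite near_withinE => /nbhs_normP[r/= r0 rP].
apply/nbhs_normP; exists r => //= w /= wr.
case: eqP => [_|/eqP wz]; first by rewrite subrr normr0.
have := rP (w - z); rewrite /= sub0r normrN distrC => /(_ wr).
rewrite subr_eq0 => /(_ wz).
by rewrite /GRing.scale/= mulr1 subrK mulrC.
Qed.

Lemma has_deriv_derive1 f z d : has_deriv f z d -> derive1 f z = d.
Proof. by move=> /has_deriv_is_derive[_]; rewrite derive1E. Qed.

Lemma derivable_has_deriv f z : derivable f z 1 -> has_deriv f z (derive1 f z).
Proof.
by move=> fz; apply: is_derive_has_deriv; apply: DeriveDef => //; rewrite derive1E.
Qed.

(** Dividing by [w - z] recovers the slope away from [z], so it is enough to
    exhibit it near [z]. *)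
Lemma has_deriv_slope C f z d : {for z, continuous C} -> C z = d ->
  (\forall w \near z, f w - f z = (w - z) * C w) -> has_deriv f z d.
Proof.
move=> Cc Cz fE.
exists (fun w => if w == z then d else (f w - f z) / (w - z)).
split=> [||w]; last 2 first.
- by rewrite eqxx.
- case: eqP => [->|/eqP wz]; first by rewrite !subrr mul0r.
  by rewrite mulrC divfK// subr_eq0.
apply: cont_near Cc; near=> w.
case: eqP => [->//|/eqP wz].
have -> : f w - f z = (w - z) * C w by near: w.
by rewrite mulrC mulKf// subr_eq0.
Unshelve. all: by end_near. Qed.

Lemma has_deriv_near f g z d : {near z, f =1 g} -> has_deriv f z d ->
  has_deriv g z d.
Proof.
move=> fg [C [Cc Cz fE]]; apply: (has_deriv_slope Cc Cz); near=> w.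
have <- : f w = g w by near: w; exact: fg.
by have <- : f z = g z by exact: nbhs_singleton fg.
Unshelve. all: by end_near. Qed.

Lemma has_deriv_continuous f z d : has_deriv f z d -> {for z, continuous f}.
Proof.
move=> [C [Cc Cz fE]].
have -> : f = (fun w => f z + (w - z) * C w).
  by apply/funext => w; rewrite -fE addrC subrK.
apply: contD; first exact: cont_cst.
by apply: contM => //; apply: contB; [exact: cont_id|exact: cont_cst].
Qed.

Lemma has_deriv_comp f g z d e : has_deriv f z d -> has_deriv g (f z) e ->
  has_deriv (g \o f) z (e * d).
Proof.
move=> fd [D [Dc Dz gE]]; have fc := has_deriv_continuous fd.
move: fd => [C [Cc Cz fE]].
exists (fun w => C w * D (f w)); split=> [||w]; last 2 first.
- by rewrite Cz Dz mulrC.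
- by rewrite /= gE fE mulrA.
by apply: contM => //; apply: continuous_comp.
Qed.

Lemma has_deriv_id z : has_deriv id z 1.
Proof. by exists (cst 1); split=> [||w]; [exact: cont_cst| |rewrite mulr1]. Qed.

Lemma has_deriv_cst c z : has_deriv (cst c) z 0.
Proof.
by exists (cst 0); split=> [||w]; [exact: cont_cst| |rewrite mulr0 subrr].
Qed.

Lemma has_derivD f g z d e : has_deriv f z d -> has_deriv g z e ->
  has_deriv (fun w => f w + g w) z (d + e).
Proof.
move=> [C [Cc Cz fE]] [D [Dc Dz gE]].
exists (fun w => C w + D w); split=> [||w]; last 2 first.
- by rewrite Cz Dz.
- by rewrite mulrDr -fE -gE; ring.
exact: contD.
Qed.

Lemma has_derivM f g z d e : has_deriv f z d -> has_deriv g z e ->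
  has_deriv (fun w => f w * g w) z (d * g z + f z * e).
Proof.
move=> fd [D [Dc Dz gE]]; have fc := has_deriv_continuous fd.
move: fd => [C [Cc Cz fE]].
exists (fun w => C w * g z + f w * D w); split=> [||w]; last 2 first.
- by rewrite Cz Dz.
- have -> : (w - z) * (C w * g z + f w * D w) =
    ((w - z) * C w) * g z + f w * ((w - z) * D w) by ring.
  by rewrite -fE -gE; ring.
by apply: contD; apply: contM => //; exact: cont_cst.
Qed.

Lemma has_derivZ c f z d : has_deriv f z d ->
  has_deriv (fun w => c * f w) z (c * d).
Proof.
move=> fd; have := has_derivM (has_deriv_cst c z) fd.
by rewrite mul0r add0r.
Qed.

Lemma has_derivV z : z != 0 -> has_deriv GRing.inv z (- (z^-1 * z^-1)).
Proof.
move=> z0; apply: (@has_deriv_slope (fun w => - (z^-1 * w^-1))) => //.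
  apply: contN; apply: contM; first exact: cont_cst.
  by apply: (@contV _ _ (fun y : K^o => y)) => //; exact: cont_id.
have zN : \forall w \near z, w != 0 by exact: cvgr_neq0 _ (@cont_id K^o z) z0.
near=> w; have w0 : w != 0 by near: w.
by field; rewrite z0 w0.
Unshelve. all: by end_near. Qed.

(** The slope of [q \o F] at [z] is the slope of [q], taken along [F], times the
    slope of [F]; where [q] has a nonzero derivative one can divide. *)
Lemma has_deriv_lift (q F : K^o -> K^o) z d e : {for z, continuous F} ->
  has_deriv q (F z) e -> e != 0 -> has_deriv (q \o F) z d ->
  has_deriv F z (d / e).
Proof.
move=> Fc [D [Dc Dz qE]] e0 [C [Cc Cz GE]].
have DFc : {for z, continuous (D \o F)} by apply: continuous_comp.
apply: (@has_deriv_slope (fun w => C w / D (F w))).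
- by apply: contM => //; apply: contV => //; rewrite Dz.
- by rewrite Cz Dz.
have DN : \forall w \near z, D (F w) != 0.
  by apply: cvgr_neq0 _ DFc _; rewrite /= Dz.
near=> w; have Dw : D (F w) != 0 by near: w.
have /(canRL (mulfK Dw)) -> : (F w - F z) * D (F w) = (w - z) * C w.
  by rewrite -GE /= qE.
by rewrite mulrA.
Unshelve. all: by end_near. Qed.

End Caratheodory.

(** * The complex plane as a metric space *)

Section Clamp.
Context {R : realType}.
Implicit Types a b x : R.

(** Precomposition with [clamp a b] turns a function continuous on the segment
    from [a] to [b] into one that is continuous on the line, and leaves its
    values on the segment unchanged. *)
Definition clamp a b x : R := Num.max a (Num.min x b).

Lemma clamp_itv a b x : a <= b -> a <= clamp a b x <= b.
Proof. by move=> ab; rewrite le_max lexx/= ge_max ab ge_min lexx orbT. Qed.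

Lemma clamp_id a b x : a <= x <= b -> clamp a b x = x.
Proof. by move=> /andP[ax xb]; rewrite /clamp (min_idPl xb) (max_idPr ax). Qed.

Lemma clamp_le a b x : a <= b -> x <= a -> clamp a b x = a.
Proof.
move=> ab xa; rewrite /clamp (min_idPl (le_trans xa ab)).
exact/max_idPl.
Qed.

Lemma clamp_ge a b x : a <= b -> b <= x -> clamp a b x = b.
Proof. by move=> ab bx; rewrite /clamp (min_idPr bx) (max_idPr ab). Qed.

Lemma continuous_clamp a b : continuous (clamp a b).
Proof.
move=> x; apply: (@continuous_max _ _ (fun=> a) (fun y => Num.min y b)).
  exact: cont_cst.
apply: (@continuous_min _ _ (fun y => y) (fun=> b)); first exact: cont_id.
exact: cont_cst.
Qed.

End Clamp.

Section ComplexPlane.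
Context {R : realType}.
Local Notation C := (Cplx R).
Implicit Types (z w : C) (x y t : R).

Lemma cmodE z : cmod z = Num.sqrt (complex.Re z ^+ 2 + complex.Im z ^+ 2).
Proof. by case: z. Qed.

Lemma cmod_normr z : `|z : R[i]| = (cmod z)%:C.
Proof. by rewrite normc_def cmodE. Qed.

Lemma cmod_ge0 z : 0 <= cmod z.
Proof. by rewrite cmodE sqrtr_ge0. Qed.

Lemma cmodM z w : cmod (z * w) = cmod z * cmod w.
Proof. exact: Normc.normcM. Qed.

Lemma cmodV z : cmod z^-1 = (cmod z)^-1.
Proof. exact: Normc.normcV. Qed.

Lemma cmod0 : cmod (0 : C) = 0.
Proof. exact: Normc.normc0. Qed.

Lemma cmod1 : cmod (1 : C) = 1.
Proof. exact: Normc.normc1. Qed.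

Lemma cmod_eq0 z : (cmod z == 0) = (z == 0).
Proof.
by apply/eqP/eqP => [/Normc.eq0_normc//|->]; exact: cmod0.
Qed.

Lemma cmod_gt0 z : (0 < cmod z) = (z != 0).
Proof. by rewrite lt_neqAle cmod_ge0 andbT eq_sym cmod_eq0. Qed.

Lemma cmodN z : cmod (- z) = cmod z.
Proof. exact: (normcN (z : Rcomplex R)). Qed.

Lemma cmodD z w : cmod (z + w) <= cmod z + cmod w.
Proof. exact: (le_normcD (z : Rcomplex R) w). Qed.

Lemma cmodB z w : cmod (z - w) <= cmod z + cmod w.
Proof. by rewrite -(cmodN w) cmodD. Qed.

Lemma cmod_real t : cmod (t%:C : C) = `|t|.
Proof. by rewrite cmodE/= expr0n addr0 sqrtr_sqr. Qed.

Lemma cmod_conj z : cmod (z^*%C : C) = cmod z.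
Proof. by case: z => a b; rewrite !cmodE/= sqrrN. Qed.

Lemma mul_conj z : z * z^*%C = ((cmod z ^+ 2)%:C : C).
Proof.
case: z => a b; rewrite cmodE/= sqr_sqrtr ?addr_ge0 ?sqr_ge0//.
by apply/eqP; rewrite eq_complex/=; apply/andP; split; apply/eqP; ring.
Qed.

Lemma Re_le_cmod z : `|complex.Re z| <= cmod z.
Proof.
by rewrite cmodE -sqrtr_sqr ler_sqrt ?addr_ge0 ?sqr_ge0// lerDl sqr_ge0.
Qed.

Lemma Im_le_cmod z : `|complex.Im z| <= cmod z.
Proof.
by rewrite cmodE -sqrtr_sqr ler_sqrt ?addr_ge0 ?sqr_ge0// lerDr sqr_ge0.
Qed.

Lemma cmod_le_ReIm z : cmod z <= `|complex.Re z| + `|complex.Im z|.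
Proof.
rewrite -(@ger0_norm _ (`|complex.Re z| + `|complex.Im z|)) ?addr_ge0//.
rewrite -sqrtr_sqr cmodE ler_sqrt ?sqr_ge0//.
rewrite sqrrD !real_normK ?num_real// -addrA [X in _ <= _ + X]addrC addrA lerDl.
by rewrite mulrn_wge0// mulr_ge0.
Qed.

Lemma cReD z w : complex.Re (z + w) = complex.Re z + complex.Re w.
Proof. by case: z w => [a b] [c d]. Qed.

Lemma cImD z w : complex.Im (z + w) = complex.Im z + complex.Im w.
Proof. by case: z w => [a b] [c d]. Qed.

Lemma cReN z : complex.Re (- z) = - complex.Re z.
Proof. by case: z. Qed.

Lemma cImN z : complex.Im (- z) = - complex.Im z.
Proof. by case: z. Qed.

Lemma cReM z w : complex.Re (z * w) =
  complex.Re z * complex.Re w - complex.Im z * complex.Im w.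
Proof. by case: z w => [a b] [c d]. Qed.

Lemma cImM z w : complex.Im (z * w) =
  complex.Re z * complex.Im w + complex.Im z * complex.Re w.
Proof. by case: z w => [a b] [c d]. Qed.

Lemma complex_eta z : z = (complex.Re z +i* complex.Im z : C).
Proof. by case: z. Qed.

(** The topology of the plane comes from a norm with values in [R[i]]; its
    balls have real radii. *)
Lemma nbhs_cmodP z (P : set C) : nbhs z P <->
  exists2 e : R, 0 < e & forall w, cmod (w - z) < e -> P w.
Proof.
split=> [/nbhs_normP[e/= e0 eP]|[e e0 eP]].
  have eE : e = (complex.Re e)%:C.
    by rewrite RRe_real// ger0_real// ltW.
  exists (complex.Re e); first by rewrite -ltcR -eE.
  move=> w wz; apply: eP => /=.
  by rewrite distrC cmod_normr eE ltcR.
apply/(@nbhs_normP R[i] C z P); exists e%:C => /=; first by rewrite ltcR.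
by move=> w /=; rewrite distrC cmod_normr ltcR => /eP.
Qed.

Lemma near_cmod z (P : C -> Prop) : (\forall w \near z, P w) ->
  exists2 e : R, 0 < e & forall w, cmod (w - z) < e -> P w.
Proof. by move=> /nbhs_cmodP. Qed.

Lemma cont_cmodP (T : topologicalType) (f : T -> C) (x : T) :
  {for x, continuous f} <->
  forall e : R, 0 < e -> \forall y \near x, cmod (f y - f x) < e.
Proof.
split=> [fc e e0|fc P /nbhs_cmodP[e e0 eP]].
  by apply: (fc [set w | cmod (w - f x) < e]); apply/nbhs_cmodP; exists e.
by apply: filterS (fc e e0) => y; exact: eP.
Qed.

Lemma cont_realP (T : topologicalType) (f : T -> R) (x : T) :
  {for x, continuous f} <->
  forall e : R, 0 < e -> \forall y \near x, `|f y - f x| < e.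
Proof.
have E := @cvgrPdist_lt R R^o T (nbhs x) (nbhs_filter x) f (f x).
split=> [fc e e0|fc].
  by have := E.1 fc e e0; apply: filterS => y; rewrite distrC.
by apply: E.2 => e e0; have := fc e e0; apply: filterS => y; rewrite distrC.
Qed.

Lemma cont_Re (T : topologicalType) (f : T -> C) (x : T) :
  {for x, continuous f} -> {for x, continuous (fun y : T => complex.Re (f y) : R)}.
Proof.
move=> /(proj1 (cont_cmodP _ _)) fc; apply: (proj2 (cont_realP _ _)) => e e0.
apply: filterS (fc e e0) => y; apply: le_lt_trans.
by rewrite -cReN -cReD Re_le_cmod.
Qed.

Lemma cont_Im (T : topologicalType) (f : T -> C) (x : T) :
  {for x, continuous f} -> {for x, continuous (fun y : T => complex.Im (f y) : R)}.
Proof.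
move=> /(proj1 (cont_cmodP _ _)) fc; apply: (proj2 (cont_realP _ _)) => e e0.
apply: filterS (fc e e0) => y; apply: le_lt_trans.
by rewrite -cImN -cImD Im_le_cmod.
Qed.

Lemma cont_complex (T : topologicalType) (f g : T -> R) (x : T) :
  {for x, continuous f} -> {for x, continuous g} ->
  {for x, continuous (fun y : T => (f y +i* g y : C))}.
Proof.
move=> /(proj1 (cont_realP _ _)) fc /(proj1 (cont_realP _ _)) gc; apply: (proj2 (cont_cmodP _ _)) => e e0.
have e2 : 0 < e / 2 by rewrite divr_gt0.
near=> y; apply: le_lt_trans (cmod_le_ReIm _) _ => /=.
by rewrite (splitr e) ltrD//; near: y; [exact: fc|exact: gc].
Unshelve. all: by end_near. Qed.

Lemma cont_of_real (T : topologicalType) (f : T -> R) (x : T) :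
  {for x, continuous f} -> {for x, continuous (fun y : T => ((f y)%:C : C))}.
Proof. by move=> fc; apply: cont_complex => //; exact: cont_cst. Qed.

Lemma contCM (T : topologicalType) (f g : T -> C) (x : T) :
  {for x, continuous f} -> {for x, continuous g} ->
  {for x, continuous (fun y : T => f y * g y : C)}.
Proof. by move=> fc gc; exact: (@contM T R[i] f g x fc gc). Qed.

Lemma cmod_convex (r t : R) z w : 0 <= t <= 1 -> cmod z < r -> cmod w < r ->
  cmod (((1 - t)%:C : C) * z + (t%:C : C) * w) < r.
Proof.
move=> /andP[t0 t1] zr wr; apply: (le_lt_trans (cmodD _ _)).
rewrite !cmodM !cmod_real !ger0_norm ?subr_ge0//.
have [->|tn] := eqVneq t 0; first by rewrite subr0 mul1r mul0r addr0.
have tp : 0 < t by rewrite lt_neqAle eq_sym tn.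
have -> : r = (1 - t) * r + t * r by ring.
by rewrite ler_ltD ?ltr_pM2l// ler_wpM2l ?subr_ge0// ltW.
Qed.

Lemma unit_disc_open : open (@unit_disc R).
Proof.
rewrite openE => z z1; apply/nbhs_cmodP; exists (1 - cmod z).
  by rewrite subr_gt0.
move=> w; rewrite ltrBrDr => h; apply: le_lt_trans h.
by rewrite (le_trans _ (cmodD _ _))// subrK.
Qed.

Lemma near_unit_disc z : unit_disc z -> \forall w \near z, unit_disc w.
Proof. by move=> zD; apply: open_nbhs_nbhs; split => //; exact: unit_disc_open. Qed.

Lemma unit_disc0 : unit_disc (0 : C).
Proof. by change (cmod (0 : C) < 1); rewrite cmod0 ltr01. Qed.

End ComplexPlane.

(** * Bisection of rectangles *)

Section Goursat.
Context {R : realType}.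
Implicit Types (a b c d e x y : R).

(** Primitives stand for integrals in all that follows: additivity in the end
    points is then an algebraic identity, and bounds come from the mean value
    theorem. *)
Lemma antiderivative (h : R -> R) a b : continuous h ->
  exists H : R -> R, forall x, a < x < b -> is_derive x 1 H (h x).
Proof.
move=> hc.
exists (fun x => \int[lebesgue_measure]_(t in `[a, x]) h t)%R => x /andP[ax xb].
have hi : lebesgue_measure.-integrable `[a, b] (EFin \o h).
  apply: continuous_compact_integrable; first exact: segment_compact.
  exact: continuous_subspaceT.
have [dF FE] := continuous_FTC1_closed xb hi ax (hc x).
exact: DeriveDef dF (etrans (esym (derive1E _ _)) FE).
Qed.

Lemma nested_intervals (u v : nat -> R) :
  (forall n, u n <= u n.+1) -> (forall n, v n.+1 <= v n) ->
  (forall n, u n <= v n) -> exists x, forall n, u n <= x <= v n.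
Proof.
move=> uS vS uv.
have ule m n : (m <= n)%N -> u m <= u n.
  by apply: (homo_leq (r := fun x y => x <= y)) => //; exact: le_trans.
have vle m n : (m <= n)%N -> v n <= v m.
  by apply: (homo_leq (r := fun x y => y <= x)) => // x y z xy yz;
    exact: le_trans yz xy.
have ub m n : u m <= v n.
  apply: (le_trans (ule _ _ (leq_maxl m n))); apply: le_trans (uv _) _.
  exact/vle/leq_maxr.
have hs : has_sup (range u).
  split; first by exists (u 0%N), 0%N.
  by exists (v 0%N) => _ [m _ <-].
exists (sup (range u)) => n; apply/andP; split.
  by apply: sup_upper_bound => //; exists n.
by apply: ge_sup; [exists (u 0%N), 0%N|move=> _ [m _ <-]].
Qed.

Lemma exists_pow2 e x : 0 < e -> exists n, x / 2 ^+ n < e.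
Proof.
move=> e0; have [n xn] : exists n, x / e < n%:R.
  exists (Num.bound `|x / e|); apply: le_lt_trans (ler_norm _) _.
  by rewrite archi_boundP.
exists n; rewrite ltr_pdivrMr ?exprn_gt0// mulrC -ltr_pdivrMr//.
by rewrite (lt_trans xn)// -natrX ltr_nat ltn_expl.
Qed.

(** Goursat's bisection: if the value on the whole rectangle is not small
    compared with the squared perimeter, this persists on one of the four
    quarters, hence on arbitrarily small rectangles around some point. *)
Lemma additive_rectangle_eq0 (Phi : R -> R -> R -> R -> R) a b c d :
  a <= b -> c <= d ->
  (forall x1 x2 x3 y1 y2, Phi x1 x3 y1 y2 = Phi x1 x2 y1 y2 + Phi x2 x3 y1 y2) ->
  (forall x1 x2 y1 y2 y3, Phi x1 x2 y1 y3 = Phi x1 x2 y1 y2 + Phi x1 x2 y2 y3) ->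
  (forall x0 y0 e, a <= x0 <= b -> c <= y0 <= d -> 0 < e ->
    exists2 r, 0 < r & forall x1 x2 y1 y2,
      a <= x1 <= x0 -> x0 <= x2 <= b -> c <= y1 <= y0 -> y0 <= y2 <= d ->
      x2 - x1 < r -> y2 - y1 < r ->
      `|Phi x1 x2 y1 y2| <= e * ((x2 - x1) + (y2 - y1)) ^+ 2) ->
  Phi a b c d = 0.
Proof.
move=> ab cd addx addy loc.
set w := b - a; set h := d - c; set L := w + h.
have w0 : 0 <= w by rewrite subr_ge0.
have h0 : 0 <= h by rewrite subr_ge0.
apply/eqP; rewrite -normr_eq0; apply/eqP/le_anti; rewrite normr_ge0 andbT.
apply/ler_addgt0Pr => e0 e0_gt0; rewrite add0r leNgt; apply/negP => big.
(* with this [e] the whole rectangle is bad; the [+ 1] covers [L = 0] *)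
pose e := e0 / (L ^+ 2 + 1).
have L2 : 0 < L ^+ 2 + 1 by rewrite ltr_wpDl ?sqr_ge0.
have e_gt0 : 0 < e by rewrite divr_gt0.
pose bad n (p : R * R) := e * (L / 2 ^+ n) ^+ 2 <
  `|Phi p.1 (p.1 + w / 2 ^+ n) p.2 (p.2 + h / 2 ^+ n)|.
have bad0 : bad 0%N (a, c).
  rewrite /bad expr0 !divr1 /= /w /h !subrKC; apply: le_lt_trans big.
  rewrite /e mulrAC ler_pdivrMr// ler_wpM2l//; first exact: ltW.
  by rewrite lerDl.
have step (np : nat * (R * R)) : exists q : R * R, bad np.1 np.2 ->
    [/\ bad np.1.+1 q,
        np.2.1 <= q.1 <= np.2.1 + w / 2 ^+ np.1.+1 &
        np.2.2 <= q.2 <= np.2.2 + h / 2 ^+ np.1.+1].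
  case: np => n [x y]; rewrite /bad/=.
  have E2 (z : R) : z / 2 ^+ n = z / 2 ^+ n.+1 + z / 2 ^+ n.+1.
    by rewrite exprS; field.
  set w' := w / 2 ^+ n.+1; set h' := h / 2 ^+ n.+1.
  have w'0 : 0 <= w' by rewrite divr_ge0.
  have h'0 : 0 <= h' by rewrite divr_ge0.
  have [H|NH] := pselect (exists2 q : R * R, bad n.+1 q &
      (x <= q.1 <= x + w') /\ (y <= q.2 <= y + h')).
    by case: H => q bq [q1 q2]; exists q.
  have small q1 q2 : x <= q1 <= x + w' -> y <= q2 <= y + h' ->
      `|Phi q1 (q1 + w') q2 (q2 + h')| <= e * (L / 2 ^+ n.+1) ^+ 2.
    by move=> h1 h2; rewrite leNgt; apply/negP => hb; apply: NH; exists (q1, q2).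
  exists (x, y) => hb; exfalso; move: hb; apply/negP; rewrite -leNgt.
  rewrite [w / _]E2 [h / _]E2 -/w' -/h' !addrA.
  rewrite (addx x (x + w')) (addy _ _ y (y + h')) (addy (x + w') _ y (y + h')).
  have -> : e * (L / 2 ^+ n) ^+ 2 =
      (e * (L / 2 ^+ n.+1) ^+ 2 + e * (L / 2 ^+ n.+1) ^+ 2) +
      (e * (L / 2 ^+ n.+1) ^+ 2 + e * (L / 2 ^+ n.+1) ^+ 2).
    by rewrite E2; ring.
  apply: (le_trans (ler_normD _ _)); apply: lerD;
    apply: (le_trans (ler_normD _ _)); apply: lerD; apply: small;
    by rewrite ?lexx ?lerDl ?w'0 ?h'0.
have [f fP] := choice step.
pose s := fix s n : R * R := if n is m.+1 then f (m, s m) else (a, c).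
have sbad n : bad n (s n).
  by elim: n => [//|n /(fP (n, s n))[]].
have E2 (z : R) n : z / 2 ^+ n = z / 2 ^+ n.+1 + z / 2 ^+ n.+1.
  by rewrite exprS; field.
have sS n := fP (n, s n) (sbad n).
have [|||x0 x0P] := @nested_intervals (fun n => (s n).1)
    (fun n => (s n).1 + w / 2 ^+ n).
- by move=> n; have [_ /andP[]] := sS n.
- by move=> n; have [_ /andP[_ h1] _] := sS n; rewrite (E2 w n) addrA lerD2r.
- by move=> n; rewrite lerDl divr_ge0.
have [|||y0 y0P] := @nested_intervals (fun n => (s n).2)
    (fun n => (s n).2 + h / 2 ^+ n).
- by move=> n; have [_ _ /andP[]] := sS n.
- by move=> n; have [_ _ /andP[_ h1]] := sS n; rewrite (E2 h n) addrA lerD2r.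
- by move=> n; rewrite lerDl divr_ge0.
have inx n : a <= (s n).1 /\ (s n).1 + w / 2 ^+ n <= b.
  elim: n => [|n [h1 h2]].
    by split=> //=; rewrite expr0 divr1 /w subrKC.
  have [_ /andP[g1 g2] _] := sS n; split; first exact: le_trans g1.
  by apply: le_trans h2; rewrite (E2 w n) addrA lerD2r.
have iny n : c <= (s n).2 /\ (s n).2 + h / 2 ^+ n <= d.
  elim: n => [|n [h1 h2]].
    by split=> //=; rewrite expr0 divr1 /h subrKC.
  have [_ _ /andP[g1 g2]] := sS n; split; first exact: le_trans g1.
  by apply: le_trans h2; rewrite (E2 h n) addrA lerD2r.
have [||r r0 rP] := loc x0 y0 e _ _ e_gt0.
- by have := x0P 0%N; rewrite /= expr0 divr1 /w subrKC.
- by have := y0P 0%N; rewrite /= expr0 divr1 /h subrKC.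
have [n nr] := @exists_pow2 r L r0.
have := sbad n; apply/negP; rewrite -leNgt.
have wn : 0 <= w / 2 ^+ n by rewrite divr_ge0.
have hn : 0 <= h / 2 ^+ n by rewrite divr_ge0.
have [/andP[x1 x2] /andP[y1 y2]] := (x0P n, y0P n).
have [[a1 a2] [c1 c2]] := (inx n, iny n).
have dE (u v : R) : u + v - u = v by rewrite addrC addKr.
apply: (le_trans (rP _ _ _ _ _ _ _ _ _ _)).
- by rewrite a1 x1.
- by rewrite x2 a2.
- by rewrite c1 y1.
- by rewrite y2 c2.
- by rewrite dE (le_lt_trans _ nr)// ler_wpM2r// lerDl.
- by rewrite dE (le_lt_trans _ nr)// ler_wpM2r// lerDr.
- by rewrite !dE -mulrDl.
Qed.

End Goursat.

(** * Goursat in real form *)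

Section Green.
Context {R : realType}.
Implicit Types (a b c d e x y : R).

Lemma derive_continuous_segment (F f : R -> R) a b :
  (forall x, a <= x <= b -> is_derive x 1 F (f x)) ->
  {within `[a, b], continuous F}.
Proof.
move=> dF; apply: derivable_within_continuous => x; rewrite in_itv/= => xab.
by have [] := dF _ xab.
Qed.

Lemma mean_value (F f : R -> R) a b : a <= b ->
  (forall x, a <= x <= b -> is_derive x 1 F (f x)) ->
  exists2 x, a <= x <= b & F b - F a = f x * (b - a).
Proof.
move=> ab dF; have [||x] := @MVT_segment R F f a b ab.
- by move=> x; rewrite in_itv/= => /andP[ax xb]; apply: dF; rewrite !ltW.
- exact: derive_continuous_segment dF.
by rewrite in_itv/= => xab FE; exists x.
Qed.

Lemma mean_value_bound (F f : R -> R) M a b : a <= b ->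
  (forall x, a <= x <= b -> is_derive x 1 F (f x)) ->
  (forall x, a <= x <= b -> `|f x| <= M) -> `|F b - F a| <= M * (b - a).
Proof.
move=> ab dF fM; have [x xab ->] := mean_value ab dF.
by rewrite normrM (@ger0_norm _ (b - a)) ?subr_ge0// ler_wpM2r ?subr_ge0// fM.
Qed.

(** [A x] and [B y] are primitives of [P x] and [Q ^~ y], so the conclusion says
    that the form [P dy + Q dx] integrates to zero along the boundary when
    [P_x = Q_y] holds pointwise. Up to affine parts of [P] and [Q], whose
    boundary integral vanishes exactly, the integral over a small rectangle is
    small compared with its squared perimeter. *)
Lemma goursat (P Q A B : R -> R -> R) a b c d : a <= b -> c <= d ->
  (forall x y, a <= x <= b -> c <= y <= d -> is_derive y 1 (A x) (P x y)) ->
  (forall x y, a <= x <= b -> c <= y <= d -> is_derive x 1 (B y) (Q x y)) ->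
  (forall x0 y0, a <= x0 <= b -> c <= y0 <= d ->
    exists p q s t : R * R -> R,
    [/\ {for (x0, y0), continuous p} /\ {for (x0, y0), continuous q},
        {for (x0, y0), continuous s} /\ {for (x0, y0), continuous t},
        p (x0, y0) = t (x0, y0) &
        forall x y, a <= x <= b -> c <= y <= d ->
          P x y = P x0 y0 + (x - x0) * p (x, y) + (y - y0) * q (x, y) /\
          Q x y = Q x0 y0 + (x - x0) * s (x, y) + (y - y0) * t (x, y)]) ->
  A b d - A b c - (A a d - A a c) = B d b - B d a - (B c b - B c a).
Proof.
move=> ab cd dA dB slope.
pose Phi x1 x2 y1 y2 := (A x2 y2 - A x2 y1) - (A x1 y2 - A x1 y1)
  - ((B y2 x2 - B y2 x1) - (B y1 x2 - B y1 x1)).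
suff: Phi a b c d = 0 by rewrite /Phi => /eqP; rewrite subr_eq0 => /eqP.
apply: (additive_rectangle_eq0 ab cd).
- by move=> x1 x2 x3 y1 y2; rewrite /Phi; ring.
- by move=> x1 x2 y1 y2 y3; rewrite /Phi; ring.
move=> x0 y0 e x0ab y0cd e0.
have [p [q [s [t [[pc qc] [sc tc] kE slopeE]]]]] := slope x0 y0 x0ab y0cd.
set k := p (x0, y0) in kE.
set q0 := q (x0, y0); set s0 := s (x0, y0).
have e2 : 0 < e / 2 by rewrite divr_gt0.
have near4 : \forall z \near (x0, y0), [/\ `|p z - k| < e / 2,
    `|q z - q0| < e / 2, `|s z - s0| < e / 2 & `|t z - k| < e / 2].
  rewrite kE.
  have H1 := (cont_realP _ _).1 pc _ e2; have H2 := (cont_realP _ _).1 qc _ e2.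
  have H3 := (cont_realP _ _).1 sc _ e2; have H4 := (cont_realP _ _).1 tc _ e2.
  near=> z; split; near: z.
  - by rewrite -kE.
  - exact: H2.
  - exact: H3.
  - exact: H4.
case/nbhs_ballP: near4 => r /= r0 rP; exists r => //.
move=> x1 x2 y1 y2 /andP[ax1 x1x0] /andP[x0x2 x2b] /andP[cy1 y1y0]
  /andP[y0y2 y2d] wr hr.
have x12 := le_trans x1x0 x0x2; have y12 := le_trans y1y0 y0y2.
set w := x2 - x1; set h := y2 - y1.
have w0 : 0 <= w by rewrite subr_ge0.
have h0 : 0 <= h by rewrite subr_ge0.
have dist (u u0 u1 u2 : R) : u1 <= u0 -> u0 <= u2 -> u1 <= u <= u2 ->
    `|u - u0| <= u2 - u1.
  move=> h1 h2 /andP[h3 h4]; rewrite ler_norml.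
  by rewrite opprB; apply/andP; split; rewrite lerB.
have small x y : x1 <= x <= x2 -> y1 <= y <= y2 ->
    [/\ `|p (x, y) - k| < e / 2, `|q (x, y) - q0| < e / 2,
        `|s (x, y) - s0| < e / 2 & `|t (x, y) - k| < e / 2].
  move=> xP yP; apply: rP; split => /=; rewrite /ball/= distrC.
    exact: le_lt_trans (dist _ _ _ _ x1x0 x0x2 xP) wr.
  exact: le_lt_trans (dist _ _ _ _ y1y0 y0y2 yP) hr.
have xin x : x1 <= x <= x2 -> a <= x <= b.
  by move=> /andP[h1 h2]; rewrite (le_trans ax1)// (le_trans h2).
have yin y : y1 <= y <= y2 -> c <= y <= d.
  by move=> /andP[h1 h2]; rewrite (le_trans cy1)// (le_trans h2).
have comb u v u' v' : `|u| <= w -> `|v| <= h -> `|u'| < e / 2 -> `|v'| < e / 2 ->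
    `|u * u' + v * v'| <= e / 2 * (w + h).
  move=> hu hv hu' hv'; apply: (le_trans (ler_normD _ _)).
  rewrite !normrM [e / 2 * _]mulrC mulrDl.
  by apply: lerD; apply: ler_pM => //; exact: ltW.
(* the primitives of the affine parts are removed: they cancel in [Phi], as
   [P_x] and [Q_y] are both [k] at the point *)
pose A' x y := A x y - (P x0 y0 * y + (x - x0) * k * y + q0 * (y - y0) ^+ 2 / 2).
pose B' y x := B y x - (Q x0 y0 * x + (y - y0) * k * x + s0 * (x - x0) ^+ 2 / 2).
have estA x : x1 <= x <= x2 -> `|A' x y2 - A' x y1| <= e / 2 * (w + h) * h.
  move=> xP; apply: (@mean_value_bound _
    (fun y => (x - x0) * (p (x, y) - k) + (y - y0) * (q (x, y) - q0))) => //.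
    move=> y yP; have dAx := dA _ _ (xin _ xP) (yin _ yP).
    apply: is_derive_eq.
    rewrite (slopeE _ _ (xin _ xP) (yin _ yP)).1 /GRing.scale/=.
    by field.
  move=> y yP; have [h1 h2 h3 h4] := small _ _ xP yP.
  by apply: comb => //; exact: dist.
have estB y : y1 <= y <= y2 -> `|B' y x2 - B' y x1| <= e / 2 * (w + h) * w.
  move=> yP; apply: (@mean_value_bound _
    (fun x => (x - x0) * (s (x, y) - s0) + (y - y0) * (t (x, y) - k))) => //.
    move=> x xP; have dBy := dB _ _ (xin _ xP) (yin _ yP).
    apply: is_derive_eq.
    rewrite (slopeE _ _ (xin _ xP) (yin _ yP)).2 /GRing.scale/=.
    by field.
  move=> x xP; have [h1 h2 h3 h4] := small _ _ xP yP.
  by apply: comb => //; exact: dist.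
have -> : Phi x1 x2 y1 y2 = (A' x2 y2 - A' x2 y1) - (A' x1 y2 - A' x1 y1)
  - ((B' y2 x2 - B' y2 x1) - (B' y1 x2 - B' y1 x1)).
  by rewrite /Phi /A' /B'; field.
have -> : e * (w + h) ^+ 2 = e / 2 * (w + h) * h + e / 2 * (w + h) * h
    + (e / 2 * (w + h) * w + e / 2 * (w + h) * w) by field.
have x1P : x1 <= x1 <= x2 by rewrite lexx.
have x2P : x1 <= x2 <= x2 by rewrite x12 lexx.
have y1P : y1 <= y1 <= y2 by rewrite lexx.
have y2P : y1 <= y2 <= y2 by rewrite y12 lexx.
by apply: (le_trans (ler_normB _ _)); apply: lerD;
  apply: (le_trans (ler_normB _ _)); apply: lerD; auto.
Unshelve. all: by end_near. Qed.

End Green.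

(** * Mean values on circles *)

Section CauchyEstimate.
Context {R : realType}.
Local Notation C := (Cplx R).

Definition polar (r theta : R) : C := (r * cos theta) +i* (r * sin theta).

Lemma cmod_polar r theta : 0 <= r -> cmod (polar r theta) = r.
Proof.
move=> r0; rewrite cmodE/= !exprMn -mulrDr cos2Dsin2 mulr1 sqrtr_sqr.
by rewrite ger0_norm.
Qed.

Lemma polar_2pi r : polar r (pi *+ 2) = polar r 0.
Proof. by rewrite /polar cos2pi sin2pi cos0 sin0. Qed.

Lemma cont_polar (T : topologicalType) (f g : T -> R) x :
  {for x, continuous f} -> {for x, continuous g} ->
  {for x, continuous (fun y : T => polar (f y) (g y))}.
Proof.
move=> fc gc; apply: cont_complex; apply: (@contM _ R) => //.
  by apply: continuous_comp => //; exact: continuous_cos.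
by apply: continuous_comp => //; exact: continuous_sin.
Qed.

(** A holomorphic function on an annulus has the same mean real part on all its
    circles; with primitives in place of integrals the means become values
    attained on the circles. In polar coordinates the Cauchy-Riemann equation
    reads [(Re g)_r = (Im g / r)_theta], and the contributions of the sides
    [theta = 0] and [theta = 2 pi] cancel. *)
Lemma circle_mean (g : C -> C) (rho a b : R) : 0 < a -> a <= b -> b < rho ->
  (forall z, 0 < cmod z < rho -> exists d, has_deriv g z d) ->
  exists theta1 theta2,
    complex.Re (g (polar b theta1)) = complex.Re (g (polar a theta2)).
Proof.
move=> a0 ab brho gd.
pose P r theta : R := complex.Re (g (polar r theta)).
pose Q r theta : R := complex.Im (g (polar r theta)) / r.
have gt0 r : a <= r <= b -> 0 < r by move=> /andP[/(lt_le_trans a0)].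
have inann r theta : a <= r <= b -> 0 < cmod (polar r theta) < rho.
  move=> rP; rewrite cmod_polar ?ltW ?gt0//.
  by move/andP: rP => [_ /le_lt_trans->].
have gc z : 0 < cmod z < rho -> {for z, continuous g}.
  by move=> /gd[d /has_deriv_continuous].
have Pc r : a <= r <= b -> continuous (P r).
  move=> rP theta; apply: cont_Re; apply: continuous_comp; last exact/gc/inann.
  by apply: cont_polar; [exact: cont_cst|exact: cont_id].
have clampP x := clamp_itv x ab.
(* clamping the radius keeps [Q] away from its pole at [0] *)
have Qc theta : continuous (fun x => Q (clamp a b x) theta).
  have clc := @continuous_clamp R a b.
  move=> x; apply: (@contM _ R (fun y => complex.Im (g (polar (clamp a b y) theta)))
    (fun y => (clamp a b y)^-1)).
    apply: cont_Im.
    apply: (@continuous_comp _ _ _ (fun y => polar (clamp a b y) theta)).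
      by apply: cont_polar; [exact: clc|exact: cont_cst].
    exact/gc/inann.
  by apply: (@contV _ R); [rewrite gt_eqF// gt0|exact: clc].
(* The primitive is a function of the integrand, so that the equal integrands at
   the angles [0] and [2 pi] receive the same one. *)
have prim (lo hi : R) : exists F : (R -> R) -> R -> R, forall h, continuous h ->
    forall x, lo < x < hi -> is_derive x 1 (F h) (h x).
  have step (h : R -> R) : exists H : R -> R, continuous h ->
      forall x, lo < x < hi -> is_derive x 1 H (h x).
    have [/(@antiderivative R h lo hi)[H HP]|hc] := pselect (continuous h).
      by exists H.
    by exists h => /hc.
  by have [F FP] := choice step; exists F.
have [FA FAP] := prim (- 1) (pi *+ 2 + 1).
have [FB FBP] := prim (a - 1) (b + 1).
have aP : a <= a <= b by rewrite lexx.
have bP : a <= b <= b by rewrite ab lexx.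
pose A x := FA (P x); pose B theta := FB (fun x => Q (clamp a b x) theta).
have pi2 : 0 <= pi *+ 2 :> R by rewrite mulrn_wge0// pi_ge0.
have thetaP (y : R) : 0 <= y <= pi *+ 2 -> - 1 < y < pi *+ 2 + 1.
  move=> /andP[y0 y2]; rewrite (lt_le_trans _ y0) ?ltrN10//=.
  by rewrite (le_lt_trans y2)// ltrDl.
have dA x y : a <= x <= b -> 0 <= y <= pi *+ 2 -> is_derive y 1 (A x) (P x y).
  by move=> xP yP; apply: FAP; [exact: Pc|exact: thetaP].
have dB x y : a <= x <= b -> 0 <= y <= pi *+ 2 -> is_derive x 1 (B y) (Q x y).
  move=> xP yP; rewrite -[in Q x y](clamp_id xP); apply: (FBP _ (Qc y)).
  move/andP: xP => [ax xb].
  by rewrite ltrBlDr (le_lt_trans ax) ?ltrDl//= (le_lt_trans xb)// ltrDl.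
have B2pi : B (pi *+ 2) = B 0.
  by congr FB; apply/funext => x; rewrite /Q polar_2pi.
have green : A b (pi *+ 2) - A b 0 - (A a (pi *+ 2) - A a 0) =
    B (pi *+ 2) b - B (pi *+ 2) a - (B 0 b - B 0 a).
  apply: (goursat ab pi2 dA dB).
  move=> r0 theta0 rP0 _.
  have r00 := gt0 _ rP0.
  have [D [G [Gc G0 GE]]] := gd _ (inann _ theta0 rP0).
  have [c [cc c0 cE]] := @is_derive_has_deriv R _ _ _ (is_derive_cos theta0).
  have [s [sc s0 sE]] := @is_derive_has_deriv R _ _ _ (is_derive_sin theta0).
  (* [E - E z0] is [(r - r0) * alpha + (theta - theta0) * beta] *)
  pose alpha (z : R * R) : C := (cos z.2 +i* sin z.2).
  pose beta (z : R * R) : C := ((r0 * c z.2) +i* (r0 * s z.2)).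
  pose E (z : R * R) : C := polar z.1 z.2.
  have fstc : {for (r0, theta0), continuous (fun z : R * R => z.1)} by exact: cvg_fst.
  have sndc : {for (r0, theta0), continuous (fun z : R * R => z.2)} by exact: cvg_snd.
  have Ec : {for (r0, theta0), continuous E} by exact: cont_polar.
  have GEc : {for (r0, theta0), continuous (G \o E)}.
    exact: (continuous_comp Ec Gc).
  have alphac : {for (r0, theta0), continuous alpha}.
    apply: cont_complex; apply: (continuous_comp sndc).
      exact: continuous_cos.
    exact: continuous_sin.
  have betac : {for (r0, theta0), continuous beta}.
    apply: cont_complex; apply: (@contM _ R); try exact: cont_cst;
      exact: (continuous_comp sndc).
  pose p z := complex.Re (alpha z * G (E z)).
  pose q z := complex.Re (beta z * G (E z)).
  pose p' z := complex.Im (alpha z * G (E z)).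
  pose q' z := complex.Im (beta z * G (E z)).
  pose I0 := complex.Im (g (polar r0 theta0)).
  have ac : {for (r0, theta0), continuous (fun z => alpha z * G (E z) : C)}.
    exact: (contCM alphac GEc).
  have bc : {for (r0, theta0), continuous (fun z => beta z * G (E z) : C)}.
    exact: (contCM betac GEc).
  have invc : {for (r0, theta0), continuous (fun z : R * R => z.1^-1)}.
    by apply: (@contV _ R fst) => //; rewrite gt_eqF.
  exists p, q, (fun z => p' z / z.1 - I0 * r0^-1 * z.1^-1), (fun z => q' z / z.1).
  split.
  - by split; [exact: (cont_Re ac)|exact: (cont_Re bc)].
  - have p'c := cont_Im ac; have q'c := cont_Im bc.
    split; last exact: (@contM _ R q' (fun z => z.1^-1) _ q'c invc).
    apply: (@contB _ R (fun z => p' z / z.1) (fun z => I0 * r0^-1 * z.1^-1)).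
      exact: (@contM _ R p' (fun z => z.1^-1) _ p'c invc).
    have cc0 := @cont_cst (R * R)%type R^o (I0 * r0^-1) (r0, theta0).
    exact: (@contM (R * R)%type R (fun=> I0 * r0^-1) (fun z : R * R => z.1^-1) _ cc0 invc). 
  - rewrite /p /q' /alpha /beta/= c0 s0 G0; case: D {G0} => D1 D2 /=.
    by field; rewrite gt_eqF.
  - move=> r theta rP _; have r0' := gt0 _ rP.
    have Eg : g (polar r theta) = g (polar r0 theta0) +
        ((r - r0)%:C * alpha (r, theta) + (theta - theta0)%:C * beta (r, theta))
          * G (E (r, theta)).
      rewrite -[LHS](subrK (g (polar r0 theta0))) GE addrC; congr (_ + _ * _).
      apply/eqP; rewrite eq_complex /polar /alpha /beta /=.
      apply/andP; split; apply/eqP.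
        rewrite !mul0r !subr0 mulrCA -cE; ring.
      rewrite !mul0r !addr0 mulrCA -sE; ring.
    have real_comb (t u : R) (x y z : C) :
        complex.Re ((t%:C * x + u%:C * y) * z) =
          t * complex.Re (x * z) + u * complex.Re (y * z) /\
        complex.Im ((t%:C * x + u%:C * y) * z) =
          t * complex.Im (x * z) + u * complex.Im (y * z).
      by case: x y z => [x1 x2] [y1 y2] [z1 z2] /=; split; ring.
    rewrite /P /Q Eg cReD cImD !(real_comb _ _ _ _ _).1 !(real_comb _ _ _ _ _).2.
    rewrite -/(p (r, theta)) -/(q (r, theta)) -/(p' (r, theta)) -/(q' (r, theta)).
    rewrite -/I0 /=; split; first by rewrite addrA.
    by field; rewrite !gt_eqF.
have [t1 t1P E1] := mean_value pi2 (fun y => dA b y bP).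
have [t2 t2P E2] := mean_value pi2 (fun y => dA a y aP).
exists t1, t2; move: green; rewrite B2pi subrr => /eqP.
rewrite subr_eq0 E1 E2 => /eqP/mulIf; apply.
by rewrite subr0 gt_eqF// mulrn_wgt0// pi_gt0.
Qed.

End CauchyEstimate.

(** * The Schwarz-Pick inequality *)

Section Schwarz.
Context {R : realType}.
Local Notation C := (Cplx R).
Implicit Types (z w d : C) (k F : C -> C).

(** The mean value property of [k z / z], whose value at [0] is [k' 0], with the
    sharp constant. *)
Lemma cauchy_estimate0 k (rho M : R) : 0 < rho ->
  (forall z, cmod z < rho -> exists d, has_deriv k z d) -> k 0 = 0 ->
  (forall z, cmod z < rho -> cmod (k z) <= M) ->
  forall d, has_deriv k 0 d -> cmod d * rho <= M.
Proof.
move=> rho0 kd k0 kM d [D [Dc D0 DE]].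
have [->|d0] := eqVneq d 0.
  rewrite cmod0 mul0r; apply: le_trans (kM 0 _); first exact: cmod_ge0.
  by rewrite cmod0.
set N := cmod d; have N0 : 0 < N by rewrite cmod_gt0.
(* the factor [d^*] makes the value [d^* * k' 0 = |d| ^ 2] at [0] real *)
pose g z : C := d^*%C * (k z / z).
have gd z : 0 < cmod z < rho -> exists e, has_deriv g z e.
  move=> /andP[z0 /kd[e ke]]; rewrite cmod_gt0 in z0.
  by eexists; apply/has_derivZ/(has_derivM ke)/has_derivV.
have gbound b : 0 < b < rho -> N * b <= M.
  move=> /andP[b0 brho].
  have : N ^+ 2 <= N * (M / b); last first.
    rewrite expr2 ler_pM2l// ler_pdivlMr//.
  apply/ler_addgt0Pr => e e0.
  have gc : {for (0 : C), continuous (fun z => complex.Re (d^*%C * D z : C) : R)}.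
    exact: (cont_Re (contCM (@cont_cst C C (d^*%C) 0) Dc)).
  have [r r0 rP] := near_cmod ((cont_realP _ _).1 gc e e0).
  (* a circle on which [g] is within [e] of its value at [0] *)
  pose a := Num.min (r / 2) b.
  have a0 : 0 < a by rewrite lt_min divr_gt0.
  have ar : a < r by rewrite gt_min ltr_pdivrMr// ltr_pMr// ltr1n.
  have ab : a <= b by rewrite ge_min lexx orbT.
  have [t1 [t2 tE]] := circle_mean a0 ab brho gd.
  have Ha : complex.Re (g (polar a t2)) = complex.Re (d^*%C * D (polar a t2) : C).
    have pa : polar a t2 != 0 by rewrite -cmod_gt0 cmod_polar// ltW.
    have kE : k (polar a t2) = polar a t2 * D (polar a t2).
      by rewrite -[LHS]subr0 -{1}k0 DE subr0.
    by rewrite /g kE [_ * D _]mulrC mulfK.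
  have := rP (polar a t2); rewrite subr0 (cmod_polar _ (ltW a0)) => /(_ ar).
  have -> : complex.Re (d^*%C * D 0 : C) = N ^+ 2.
    by rewrite D0 mulrC mul_conj.
  rewrite -Ha -tE distrC => /ltr_normlW; rewrite ltrBlDr => /ltW Hlt.
  apply: le_trans Hlt _.
  rewrite addrC lerD2r (le_trans (ler_norm _))// (le_trans (Re_le_cmod _))//.
  rewrite /g !cmodM cmod_conj cmodV (cmod_polar _ (ltW b0)).
  rewrite ler_pM2l// ler_pM2r ?invr_gt0//; apply: kM.
  by rewrite (cmod_polar _ (ltW b0)).
rewrite -/N leNgt; apply/negP => Mlt.
have M0 : 0 <= M.
  by apply: le_trans (kM 0 _); [exact: cmod_ge0|rewrite cmod0].
pose b := (rho + M / N) / 2.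
have MN : M / N < rho by rewrite ltr_pdivrMr// mulrC.
have MN0 : 0 <= M / N by rewrite divr_ge0// ltW.
have : N * b <= M.
  apply: gbound; rewrite /b; apply/andP; split.
    by rewrite divr_gt0// ltr_wpDr.
  by rewrite ltr_pdivrMr// mulr_natr mulr2n ltrD2l.
apply/negP; rewrite -ltNge mulrC -ltr_pdivrMr// /b ltr_pdivlMr//.
by rewrite mulr_natr mulr2n ltrD2r.
Qed.

Lemma cauchy_estimate k z (rho M : R) d : 0 < rho ->
  (forall w, cmod (w - z) < rho -> exists e, has_deriv k w e) ->
  (forall w, cmod (w - z) < rho -> cmod (k w - k z) <= M) ->
  has_deriv k z d -> cmod d * rho <= M.
Proof.
move=> rho0 kd kM dz.
have shift w e : has_deriv k (w + z) e ->
    has_deriv (fun w => k (w + z) - k z) w e.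
  move=> kwe; rewrite -[e]addr0.
  apply: has_derivD; last exact: has_deriv_cst.
  rewrite -[e]mulr1; apply: (@has_deriv_comp _ (fun w => w + z) k) => //.
  rewrite -[X in has_deriv _ _ X]addr0.
  by apply: has_derivD; [exact: has_deriv_id|exact: has_deriv_cst].
apply: (@cauchy_estimate0 (fun w => k (w + z) - k z)) => //.
- move=> w wr; have [|e ke] := kd (w + z); first by rewrite addrK.
  by exists e; exact: shift.
- by rewrite add0r subrr.
- by move=> w wr; apply: kM; rewrite addrK.
- by apply: shift; rewrite add0r.
Qed.

Definition moebius (a z : C) : C := (z + a) / (1 + a^*%C * z).

Lemma moebius_denom a z : unit_disc a -> cmod z <= 1 -> 1 + a^*%C * z != 0.
Proof.
move=> a1 z1; apply/eqP => /eqP; rewrite addrC addr_eq0 => /eqP E.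
have : cmod (a^*%C * z : C) = 1 by rewrite E cmodN cmod1.
rewrite cmodM cmod_conj => E1; move: a1; rewrite /unit_disc/= -E1.
by rewrite ltNge ler_piMr// cmod_ge0.
Qed.

Lemma cmod_sqr z : cmod z ^+ 2 = complex.Re z ^+ 2 + complex.Im z ^+ 2.
Proof. by rewrite cmodE sqr_sqrtr// addr_ge0// sqr_ge0. Qed.

Lemma moebius_disc a z : unit_disc a -> unit_disc z -> unit_disc (moebius a z).
Proof.
move=> a1 z1; have D0 := moebius_denom a1 (ltW z1).
rewrite /unit_disc/= /moebius cmodM cmodV ltr_pdivrMr ?cmod_gt0// mul1r.
rewrite -(@ltr_pXn2r _ 2) ?nnegrE ?cmod_ge0//.
have a2 : cmod a ^+ 2 < 1 by rewrite expr_lt1// cmod_ge0.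
have z2 : cmod z ^+ 2 < 1 by rewrite expr_lt1// cmod_ge0.
move: a2 z2; rewrite !cmod_sqr; case: a {a1 D0} => a b; case: z {z1} => x y /= a2 z2.
rewrite -subr_gt0.
have -> : (1 + (a * x - - b * y)) ^+ 2 + (0 + (a * y + - b * x)) ^+ 2 -
  ((x + a) ^+ 2 + (y + b) ^+ 2) =
  (1 - (a ^+ 2 + b ^+ 2)) * (1 - (x ^+ 2 + y ^+ 2)) by ring.
by rewrite mulr_gt0// subr_gt0.
Qed.

Lemma moebius_deriv a z : unit_disc a -> unit_disc z ->
  has_deriv (moebius a) z ((1 - (cmod a ^+ 2)%:C) / (1 + a^*%C * z) ^+ 2).
Proof.
move=> a1 z1; have D0 := moebius_denom a1 (ltW z1).
have Nd : has_deriv (fun w : C => w + a) z (1 + 0).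
  by apply: has_derivD; [exact: has_deriv_id|exact: has_deriv_cst].
have Dd : has_deriv (fun w : C => 1 + a^*%C * w) z (0 + a^*%C * 1).
  apply: has_derivD; first exact: has_deriv_cst.
  by apply: has_derivZ; exact: has_deriv_id.
have := has_derivM Nd (has_deriv_comp Dd (has_derivV D0)).
congr (has_deriv _ _ _).
rewrite -mul_conj /=; field.
exact: D0.
Qed.

(** The Schwarz lemma at [0], moved to [z] and [F z] by automorphisms of the
    disc. *)
Lemma schwarz_pick F z d :
  (forall w, unit_disc w -> unit_disc (F w)) ->
  (forall w, unit_disc w -> exists e, has_deriv F w e) ->
  unit_disc z -> has_deriv F z d ->
  cmod d * (1 - cmod z ^+ 2) <= 1 - cmod (F z) ^+ 2.
Proof.
move=> FD Fd z1 dz; have Fz1 := FD _ z1.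
have NFz1 : unit_disc (- F z) by rewrite /unit_disc/= cmodN.
pose k := moebius (- F z) \o F \o moebius z.
have m0 : moebius z 0 = z by rewrite /moebius add0r mulr0 addr0 divr1.
have kd w : unit_disc w -> exists e, has_deriv k w e.
  move=> w1; have mw := moebius_disc z1 w1; have [e Fe] := Fd _ mw.
  eexists; apply: (has_deriv_comp (moebius_deriv z1 w1)).
  by apply: (has_deriv_comp Fe); apply: moebius_deriv => //; exact: FD.
have k0 : k 0 = 0 by rewrite /k/= m0 /moebius subrr mul0r.
have kM w : cmod w < 1 -> cmod (k w) <= 1.
  by move=> w1; apply/ltW/moebius_disc => //; exact/FD/moebius_disc.
have a2 : cmod z ^+ 2 < 1 by rewrite expr_lt1// cmod_ge0.
have b2 : cmod (F z) ^+ 2 < 1 by rewrite expr_lt1// cmod_ge0.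
have dz' : has_deriv F (moebius z 0) d by rewrite m0.
have md : has_deriv (moebius (- F z)) (F (moebius z 0)) (1 - (cmod (F z) ^+ 2)%:C)^-1.
  rewrite m0; have := moebius_deriv NFz1 Fz1; congr (has_deriv _ _ _).
  have -> : (- F z)^*%C * F z = - (cmod (F z) ^+ 2)%:C :> C.
    by rewrite rmorphN mulNr mulrC mul_conj.
  rewrite cmodN expr2 invfM mulrA divff ?mul1r// subr_eq0 eq_sym.
  by rewrite -(rmorph1 (real_complex R)) (inj_eq (@complexI R)) lt_eqF.
have dk := has_deriv_comp (moebius_deriv z1 (@unit_disc0 R))
  (has_deriv_comp dz' md).
have := cauchy_estimate0 ltr01 kd k0 kM dk.
rewrite mulr0 addr0 expr1n divr1 mulr1 !cmodM cmodV.
have E (r : R) : r < 1 -> cmod (1 - r%:C : C) = 1 - r.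
  move=> r1; have -> : 1 - r%:C = (1 - r)%:C :> C by rewrite rmorphB rmorph1.
  by rewrite cmod_real ger0_norm// subr_ge0 ltW.
by rewrite !E// -mulrA mulrC ler_pdivrMr ?subr_gt0// mul1r.
Qed.

End Schwarz.

(** * Continuity of complex derivatives *)

Section ContinuousDerivative.
Context {R : realType}.
Local Notation C := (Cplx R).
Implicit Types (z w d : C) (k : C -> C).

Lemma is_derive_along_curve k (gam : R -> C) (t dx dy : R) d :
  is_derive t 1 (fun s => complex.Re (gam s)) dx ->
  is_derive t 1 (fun s => complex.Im (gam s)) dy ->
  has_deriv k (gam t) d ->
  is_derive t 1 (fun s => complex.Re (k (gam s))) (complex.Re (d * (dx +i* dy))) /\
  is_derive t 1 (fun s => complex.Im (k (gam s))) (complex.Im (d * (dx +i* dy))).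
Proof.
move=> /(@is_derive_has_deriv R) dX /(@is_derive_has_deriv R) dY [G [Gc G0 GE]].
have gamc : {for t, continuous gam}.
  rewrite (_ : gam = fun s => (complex.Re (gam s) +i* complex.Im (gam s))).
    by apply: cont_complex; [exact: has_deriv_continuous dX|exact: has_deriv_continuous dY].
  by apply/funext => s; exact: complex_eta.
move: dX dY => [X [Xc X0 XE]] [Y [Yc Y0 YE]].
have Fc : {for t, continuous (fun s : R => (X s +i* Y s : C) * G (gam s) : C)}.
  have c1 : {for t, continuous (fun s : R => (X s +i* Y s : C))} by exact: cont_complex.
  have c2 : {for t, continuous (G \o gam)} by exact: continuous_comp gamc Gc.
  exact: contCM c1 c2.
pose S (s : R) : C := (X s +i* Y s : C) * G (gam s).
have E s : k (gam s) - k (gam t) = ((s - t)%:C : C) * S s.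
  rewrite GE /S [RHS]mulrA; congr (_ * _).
  rewrite [LHS]complex_eta cReD cImD cReN cImN XE YE.
  by apply/eqP; rewrite eq_complex/= !mul0r subr0 addr0 !eqxx.
split; apply: (@has_deriv_is_derive R).
- exists (fun s => complex.Re (S s)).
  split; first exact: (cont_Re Fc).
    by rewrite /S X0 Y0 G0 mulrC.
  move=> s; rewrite -cReN -cReD E cReM.
  by rewrite /= mul0r subr0.
- exists (fun s => complex.Im (S s)).
  split; first exact: (cont_Im Fc).
    by rewrite /S X0 Y0 G0 mulrC.
  move=> s; rewrite -cImN -cImD E cImM.
  by rewrite /= mul0r addr0.
Qed.

(** The mean value theorem along the segment, for the component of [k] in the
    direction of the increment [k w' - k w]. *)
Lemma lipschitz_segment k z (r L : R) :
  (forall w, cmod (w - z) < r -> exists2 d, has_deriv k w d & cmod d <= L) ->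
  forall w w', cmod (w - z) < r -> cmod (w' - z) < r ->
    cmod (k w' - k w) <= L * cmod (w' - w).
Proof.
move=> kd w w' wr wr'.
set D := k w' - k w.
have [->|D0] := eqVneq D 0.
  rewrite cmod0 mulr_ge0 ?cmod_ge0//.
  by have [d _] := kd w wr; apply: le_trans; exact: cmod_ge0.
pose gam (t : R) : C := w + (t%:C : C) * (w' - w).
have gamr t : 0 <= t <= 1 -> cmod (gam t - z) < r.
  move=> t01.
  have -> : gam t - z = ((1 - t)%:C : C) * (w - z) + (t%:C : C) * (w' - z).
    by rewrite /gam rmorphB rmorph1; ring.
  exact: cmod_convex.
have gamRe (t : R) : is_derive t 1 (fun s => complex.Re (gam s)) (complex.Re (w' - w)).
  rewrite (_ : (fun s => _) = fun s => complex.Re w + s * complex.Re (w' - w)).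
    by apply: is_derive_eq; rewrite /GRing.scale/=; ring.
  by apply/funext => s; rewrite /gam [LHS]cReD cReM/= mul0r subr0.
have gamIm (t : R) : is_derive t 1 (fun s => complex.Im (gam s)) (complex.Im (w' - w)).
  rewrite (_ : (fun s => _) = fun s => complex.Im w + s * complex.Im (w' - w)).
    by apply: is_derive_eq; rewrite /GRing.scale/=; ring.
  by apply/funext => s; rewrite /gam [LHS]cImD cImM/= mul0r addr0.
have kD t : 0 <= t <= 1 -> has_deriv k (gam t) (derive1 k (gam t)) /\
    cmod (derive1 k (gam t)) <= L.
  by move=> /gamr/kd[d kd' dL]; rewrite (has_deriv_derive1 kd').
pose h t := complex.Re (D^*%C * k (gam t) : C).
pose h' t := complex.Re (D^*%C * derive1 k (gam t) * (w' - w) : C).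
have [t t01|t t01] := @mean_value R h h' 0 1 ler01.
  have kt := has_derivZ (D^*%C : C) (kD _ t01).1.
  have [+ _] := is_derive_along_curve (gamRe t) (gamIm t) kt.
  by rewrite -complex_eta.
rewrite subr0 mulr1 /h -cReN -cReD -mulrBr /gam rmorph0 rmorph1 mul0r mul1r addr0.
rewrite subrKC -/D mulrC mul_conj /= => E.
have : cmod D ^+ 2 <= cmod D * (L * cmod (w' - w)).
  rewrite E (le_trans (ler_norm _))// (le_trans (Re_le_cmod _))//.
  rewrite !cmodM cmod_conj -mulrA ler_wpM2l ?cmod_ge0//.
  by rewrite ler_wpM2r ?cmod_ge0// (kD _ t01).2.
by rewrite expr2 ler_pM2l// cmod_gt0.
Qed.

(** Complex differentiability near a point makes the derivative continuous
    there: by the Cauchy estimate [k] is Lipschitz, so the translates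
    [k (_ + h) - k] are uniformly small, and so are their derivatives. *)
Lemma derive1_continuous k z : (\forall w \near z, exists d, has_deriv k w d) ->
  {for z, continuous (derive1 k)}.
Proof.
move=> kd; have [dz kz] := nbhs_singleton kd.
have kc := (cont_cmodP _ _).1 (has_deriv_continuous kz) _ ltr01.
have [r0 r0_gt0 r0P] := near_cmod (filterI kd kc).
(* a disc of radius [2 r] around a point within [2 r] of [z] stays where [k] is
   holomorphic *)
pose r := r0 / 4.
have r_gt0 : 0 < r by rewrite divr_gt0.
have r4 : r + r + (r + r) = r0 by rewrite /r; field.
have bound w : cmod (w - z) < r + r ->
    exists2 d, has_deriv k w d & cmod d <= (r^-1 : R).
  move=> wr; have wr0 : cmod (w - z) < r0.
    by rewrite (lt_trans wr)// -r4 ltrDl addr_gt0.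
  have [[d kw] kw1] := r0P _ wr0; exists d => //.
  rewrite -[r^-1]mul1r ler_pdivlMr//.
  have inside w' : cmod (w' - w) < r + r -> cmod (w' - z) < r0.
    move=> h; rewrite -r4 (le_lt_trans _ (ltrD h wr))//.
    by rewrite (le_trans _ (cmodD _ _))// subrKA.
  have rr : 0 < r + r by rewrite addr_gt0.
  have : cmod d * (r + r) <= 2.
    apply: (cauchy_estimate rr _ _ kw) => [w' /inside/r0P[]//|w' w'r].
    have -> : k w' - k w = (k w' - k z) - (k w - k z) by ring.
    rewrite (le_trans (cmodB _ _))//.
    by have [_ /ltW h] := r0P _ (inside _ w'r); rewrite lerD// ltW.
  by rewrite mulrDr -[2]/(1 + 1 : R) => h; lra.
have lip := lipschitz_segment bound.
apply: (proj2 (cont_cmodP _ _)) => e e0.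
have d_gt0 : 0 < Num.min r (e * r ^+ 2 / 2).
  by rewrite lt_min r_gt0/= divr_gt0// mulr_gt0// exprn_gt0.
have : \forall w \near z, cmod (w - z) < Num.min r (e * r ^+ 2 / 2).
  by apply/nbhs_cmodP; exists (Num.min r (e * r ^+ 2 / 2)).
apply: filterS => w; rewrite lt_min => /andP[wr we].
have [|dw kw _] := bound w; first by rewrite (lt_trans wr)// ltrDl.
have [|dz' kz' _] := bound z; first by rewrite subrr cmod0 addr_gt0.
rewrite (has_deriv_derive1 kw) (has_deriv_derive1 kz').
have shift v d : has_deriv k (v + (w - z)) d ->
    has_deriv (fun v => k (v + (w - z))) v d.
  move=> kv; rewrite -[d]mulr1.
  apply: (@has_deriv_comp _ (fun v => v + (w - z)) k) => //.
  rewrite -[X in has_deriv _ _ X]addr0.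
  by apply: has_derivD; [exact: has_deriv_id|exact: has_deriv_cst].
pose h v := k (v + (w - z)) + - 1 * k v.
have near1 v : cmod (v - z) < r -> cmod (v - z) < r + r.
  by move=> vr; rewrite (lt_trans vr)// ltrDl.
have near2 v : cmod (v - z) < r -> cmod (v + (w - z) - z) < r + r.
  by move=> vr; rewrite addrAC (le_lt_trans (cmodD _ _))// ltrD.
have hE : h = fun v => k (v + (w - z)) - k v by apply/funext => v; rewrite /h mulN1r.
have hd : has_deriv h z (dw + - 1 * dz').
  by apply: has_derivD; [apply: shift; rewrite subrKC|exact: has_derivZ].
have : cmod (dw + - 1 * dz') * r <= r^-1 * cmod (w - z) + r^-1 * cmod (w - z).
  apply: (cauchy_estimate r_gt0 _ _ hd) => v vr.
    have [d1 k1 _] := bound _ (near2 _ vr); have [d2 k2 _] := bound _ (near1 _ vr).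
    by exists (d1 + - 1 * d2); apply: has_derivD; [exact: shift|exact: has_derivZ].
  rewrite hE (le_trans (cmodB _ _))//; apply: lerD.
    apply: (le_trans (lip _ _ (near1 _ vr) (near2 _ vr))).
    by rewrite addrAC subrr add0r.
  have zr : cmod (z - z) < r by rewrite subrr cmod0.
  apply: (le_trans (lip _ _ (near1 _ zr) (near2 _ zr))).
  by rewrite addrAC subrr add0r.
rewrite mulN1r -ler_pdivlMr// => /le_lt_trans; apply.
rewrite ltr_pdivrMr//.
have xr : r^-1 * cmod (w - z) < e * r / 2.
  rewrite mulrC ltr_pdivrMr//.
  by have -> : e * r / 2 * r = e * r ^+ 2 / 2 by field.
by rewrite [ltRHS](splitr (e * r)) ltrD.
Qed.

End ContinuousDerivative.

(** * Lifting maps from the disc through a covering *)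

Section RealInduction.
Context {R : realType}.

(** Propagation from [s] to [t] goes to the right, as suits the existence of a
    lift up to a given time. *)
Lemma real_induction (P : R -> Prop) (a b : R) : a <= b -> P a ->
  (forall x, a <= x <= b -> exists2 e, 0 < e & forall s t,
     a <= s -> s <= t -> t <= b -> `|s - x| < e -> `|t - x| < e -> P s -> P t) ->
  P b.
Proof.
move=> ab Pa step; pose S := [set x : R | a <= x <= b /\ P x].
have Sa : S a by rewrite /S/= lexx.
have hs : has_sup S by split; [exists a|exists b => x [/andP[]]].
have ac : a <= sup S by exact: sup_upper_bound.
have cb : sup S <= b by apply: ge_sup; [exists a|move=> x [/andP[]]].
have [|e e0 eP] := step (sup S); first by rewrite ac cb.
have [s [/andP[as_ sb] Ps] es] := sup_adherent e0 hs.
have sc : s <= sup S by apply: sup_upper_bound => //; split=> //; rewrite as_ sb.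
pose t := Num.min b (sup S + e / 2).
have e2 : 0 < e / 2 by rewrite divr_gt0.
have ct : sup S <= t by rewrite le_min cb lerDl ltW.
have Pt : P t.
  apply: (eP s) => //.
  - exact: le_trans ct.
  - by rewrite ge_min lexx.
  - by rewrite distrC ger0_norm ?subr_ge0// ltrBlDr addrC -ltrBlDr.
  - rewrite ger0_norm ?subr_ge0// ltrBlDr gt_min; apply/orP; right.
    by rewrite addrC ltrD2r ltr_pdivrMr// ltr_pMr// ltr1n.
have : t <= sup S.
  apply: sup_upper_bound => //; split=> //.
  by rewrite (le_trans ac ct) ge_min lexx.
rewrite ge_min => /orP[bc|]; last by rewrite gerDl leNgt e2.
suff -> : b = t by [].
by rewrite /t (min_idPl _)// (le_trans bc)// lerDl ltW.
Qed.

Lemma continuous_glue (S T : topologicalType) (phi : S -> R) (r : R)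
    (A B : S -> T) :
  continuous phi -> continuous A -> continuous B ->
  (forall x, phi x = r -> A x = B x) ->
  continuous (fun x => if phi x <= r then A x else B x).
Proof.
move=> phic Ac Bc AB x; have [xr|rx|xr] := ltgtP (phi x) r.
- apply: (@cont_near _ _ A); last exact: Ac.
  have n : \forall u \near x, phi u < r := phic x _ (lt_nbhsl xr).
  by near=> u; have /ltW -> // : phi u < r by near: u.
- apply: (@cont_near _ _ B); last exact: Bc.
  have n : \forall u \near x, r < phi u := phic x _ (lt_nbhsr rx).
  by near=> u; rewrite leNgt; have -> // : r < phi u by near: u.
- move=> W; rewrite xr lexx => WA; have WB := WA; rewrite (AB x xr) in WB.
  have nA : \forall u \near x, W (A u) := Ac x W WA.
  have nB : \forall u \near x, W (B u) := Bc x W WB.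
  rewrite -[_ _]/(\forall u \near x, W (if phi u <= r then A u else B u)).
  by near=> u; case: ifP => _; near: u.
Unshelve. all: by end_near. Qed.

End RealInduction.

Section Lifting.
Context {R : realType} {M : riemann_surface R} (pi : Cplx R -> M).
Hypothesis pi_cov : disc_covering pi.
Local Notation C := (Cplx R).

Lemma evenly_covered_sheets (p : M) :
  exists (V : set M) (I : Type) (U : I -> set C) (sigma : I -> M -> C),
  [/\ open_nbhs p V,
      forall w, unit_disc w -> V (pi w) -> exists i, U i w,
      forall i w, U i w -> [/\ nbhs w (U i), unit_disc w, V (pi w) & sigma i (pi w) = w],
      forall i j w, U i w -> U j w -> i = j &
      forall i q, V q ->
        [/\ U i (sigma i q), pi (sigma i q) = q & {for q, continuous (sigma i)}]].
Proof.
have [_ _ /(_ p)[V Vp [I [U [sigma [Uo Utriv UE sP]]]]]] := pi_cov.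
exists V, I, U, sigma.
have UP i w : U i w -> unit_disc w /\ V (pi w).
  by move=> Uiw; have : (\bigcup_i U i) w by [exists i]; rewrite UE.
split => //.
- by move=> w wD Vw; have : (\bigcup_i U i) w by [rewrite UE]; move=> [i _]; exists i.
- move=> i w Uiw; have [wD Vw] := UP _ _ Uiw; split => //.
    by apply: open_nbhs_nbhs; split => //; exact: Uo.
  by have [_ _] := sP i; exact.
- by move=> i j w Ui Uj; apply: (Utriv i j Logic.I Logic.I); exists w.
- move=> i q Vq; have [UV sc sK] := sP i.
  have [w Uiw wq] : (pi @` U i) q by rewrite UV.
  rewrite -wq sK//; split => //.
  move: sc; rewrite continuous_open_subspace; last by case: Vp.
  by apply; rewrite wq inE.
Qed.

(** Sheets are disjoint, so lifts that meet stay in the same sheet. *)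
Lemma path_lift_unique (l1 l2 : R -> C) (gam : R -> M) :
  continuous l1 -> continuous l2 ->
  (forall t, t <= 1 -> unit_disc (l1 t) /\ pi (l1 t) = gam t) ->
  (forall t, t <= 1 -> unit_disc (l2 t) /\ pi (l2 t) = gam t) ->
  l1 0 = l2 0 -> l1 1 = l2 1.
Proof.
move=> c1 c2 L1 L2 l0.
apply: (@real_induction _ (fun t => l1 t = l2 t) 0 1) => // x /andP[x0 x1].
have [V [I [U [sigma [[_ Vx] Ucov UP Utriv sP]]]]] := evenly_covered_sheets (gam x).
have [[D1 E1] [D2 E2]] := (L1 _ x1, L2 _ x1).
have [||i Ui] := Ucov (l1 x); rewrite ?E1//.
have [||j Uj] := Ucov (l2 x); rewrite ?E2//.
have [Ni _ _ _] := UP _ _ Ui; have [Nj _ _ _] := UP _ _ Uj.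
have n1 : \forall t \near x, U i (l1 t) := c1 x _ Ni.
have n2 : \forall t \near x, U j (l2 t) := c2 x _ Nj.
have [e /= e0 eP] := (@nbhs_ballP R _ _ _).1 (filterI n1 n2).
exists e => // s t s0 st t1 sx tx lst.
have [Uis Ujs] : U i (l1 s) /\ U j (l2 s) by apply: eP; rewrite /ball/= distrC.
have [Uit Ujt] : U i (l1 t) /\ U j (l2 t) by apply: eP; rewrite /ball/= distrC.
have ij : i = j by apply: Utriv Uis _; rewrite lst.
have [_ _ _ <-] := UP _ _ Uit; have [_ _ _ <-] := UP _ _ Ujt.
by rewrite (L1 _ t1).2 (L2 _ t1).2 ij.
Qed.

Variables (G : C -> M) (w0 : C).
Hypotheses (Gc : forall z, unit_disc z -> {for z, continuous G})
  (w0D : unit_disc w0) (pi_w0 : pi w0 = G 0).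

(** Before time [0] the ray rests at the centre, so that its lifts are curves on
    the whole line. *)
Let ray (z : C) (t : R) : M := G (((clamp 0 1 t)%:C : C) * z).

Let ray_lift (z : C) (T : R) (l : R -> C) : Prop :=
  [/\ continuous l, l 0 = w0 &
      forall t, t <= T -> unit_disc (l t) /\ pi (l t) = ray z t].

Let ray_in_disc z t : unit_disc z -> unit_disc (((clamp 0 1 t)%:C : C) * z).
Proof.
have /andP[c0 c1] := clamp_itv t (@ler01 R).
rewrite /unit_disc/= cmodM cmod_real ger0_norm//; apply: le_lt_trans.
by rewrite ler_piMl// cmod_ge0.
Qed.

Let ray_continuous z t : unit_disc z ->
  {for (z, t), continuous (fun zt : C * R => ray zt.1 zt.2)}.
Proof.
move=> zD; pose scal (zt : C * R) : C := ((clamp 0 1 zt.2)%:C : C) * zt.1.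
have sc : {for (z, t), continuous scal}.
  have c1 : {for (z, t), continuous (fun zt : C * R => ((clamp 0 1 zt.2)%:C : C))}.
    apply: cont_of_real; apply: (@continuous_comp _ _ _ snd (clamp 0 1)).
      exact: cvg_snd.
    exact: continuous_clamp.
  have c2 : {for (z, t), continuous (fun zt : C * R => zt.1)} by exact: cvg_fst.
  exact: contCM c1 c2.
exact: (continuous_comp sc (Gc (ray_in_disc t zD))).
Qed.

(** The lifts along the rays near [z0] can be prolonged together: over an evenly
    covered set they all follow the same sheet. *)
Let rays_lift_near z0 : unit_disc z0 -> exists L : C -> R -> C,
  (\forall z \near z0, ray_lift z 1 (L z)) /\ {for z0, continuous (L ^~ 1)}.
Proof.
move=> z0D; have nearD := near_unit_disc z0D.
pose P T := exists L : C -> R -> C,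
  (\forall z \near z0, ray_lift z T (L z)) /\ {for z0, continuous (L ^~ T)}.
apply: (@real_induction _ P 0 1) => //.
  exists (fun _ _ => w0); split; last exact: cont_cst.
  apply: filterS nearD => z zD; split => // [t|t t0]; first exact: cont_cst.
  by split=> //; rewrite pi_w0 /ray clamp_le// mul0r.
move=> x x01.
have [V [I [U [sigma [[Vo Vx] Ucov UP Utriv sP]]]]] := evenly_covered_sheets (ray z0 x).
have : \forall zt \near (z0, x), V (ray zt.1 zt.2).
  by apply: (ray_continuous z0D); exact: open_nbhs_nbhs.
move=> [[A B] /= [nA /nbhs_ballP[e /= e0 eB]] ABV].
exists e; first exact: e0.
move=> s t s0 st t1 sx tx [L [Ll Lc]].
have V_mid z u : A z -> s <= u <= t -> V (ray z u).
  move=> Az /andP[su ut]; apply: (ABV (z, u)); split => //; apply: eB => /=.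
  rewrite /ball/= distrC ltr_norml; move: sx tx; rewrite !ltr_norml.
  by move=> /andP[h1 h2] /andP[h3 h4]; apply/andP; split; lra.
have sst : s <= s <= t by rewrite lexx.
have [cL0 L00 L0P] := nbhs_singleton Ll.
have [L0D L0E] := L0P _ (lexx s).
have Az0 : A z0 := nbhs_singleton nA.
have [||i Ui] := Ucov (L z0 s) => //; first by rewrite L0E; exact: V_mid.
have [NUi _ _ _] := UP _ _ Ui.
have nearU : \forall z \near z0, U i (L z s) := Lc _ NUi.
pose B' z u := sigma i (ray z (clamp s t u)).
exists (fun z u => if u <= s then L z u else B' z u); split.
  near=> z.
  have Az : A z by near: z.
  have zD : unit_disc z by near: z.
  have Uz : U i (L z s) by near: z.
  have [cL L0 LP] : ray_lift z s (L z) by near: z.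
  have B'c : continuous (B' z).
    move=> u; have [_ _ sc] := sP i _ (V_mid _ _ Az (clamp_itv u st)).
    have cc : {for u, continuous (fun u : R => (z, clamp s t u) : C * R)}.
      exact: (cont_pair (@cont_cst _ _ z u) (@continuous_clamp _ s t u)).
    have rc := continuous_comp cc (@ray_continuous z (clamp s t u) zD).
    exact: (continuous_comp rc sc).
  split.
  - apply: (continuous_glue (phi := fun u : R => u) _ cL B'c).
      by move=> u; exact: cont_id.
    move=> _ ->; rewrite /B' (clamp_id sst) -(LP _ (lexx s)).2.
    by have [_ _ _ ->] := UP _ _ Uz.
  - by rewrite s0.
  - move=> u ut; case: (leP u s) => [/LP//|/ltW su].
    have sut : s <= u <= t by rewrite su.
    rewrite /B' (clamp_id sut); have [h1 h2 _] := sP i _ (V_mid _ _ Az sut).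
    by have [_ ? _ _] := UP _ _ h1.
have tst : s <= t <= t by rewrite lexx st.
case: (leP t s) => [ts|_].
  by have -> : t = s by apply/le_anti; rewrite ts st.
rewrite /B' (clamp_id tst).
have [_ _ sc] := sP i _ (V_mid _ _ Az0 tst).
have cc : {for z0, continuous (fun z : C => (z, t) : C * R)}.
  exact: (cont_pair (@cont_id _ z0) (@cont_cst _ _ t z0)).
have rc := continuous_comp cc (@ray_continuous z0 t z0D).
exact: (continuous_comp rc sc).
Unshelve. all: by end_near. Qed.

(** The disc is star-shaped, hence maps from it lift through the covering: lift
    along the rays from the centre. *)
Lemma lift_disc : exists F : C -> C, forall z, unit_disc z ->
  [/\ unit_disc (F z), pi (F z) = G z & {for z, continuous F}].
Proof.
have ends z : exists w, unit_disc z -> exists2 l, ray_lift z 1 l & w = l 1.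
  have [zD|nz] := pselect (unit_disc z); last by exists 0.
  have [L [/nbhs_singleton Ll _]] := rays_lift_near zD.
  by exists (L z 1) => _; exists (L z).
have [F FP] := choice ends.
exists F => z zD; have [l [lc l0 lP] Fz] := FP _ zD.
have [D1 E1] := lP _ (lexx 1).
split; rewrite ?Fz// ?E1; first by rewrite /ray clamp_id ?lexx ?ler01// mul1r.
have [L [Ll Lc]] := rays_lift_near zD.
apply: cont_near Lc; near=> z'.
have z'D : unit_disc z' by near: z'; exact: near_unit_disc.
have [l' [l'c l'0 l'P] ->] := FP _ z'D.
have [L'c L'0 L'P] : ray_lift z' 1 (L z') by near: z'.
by apply: (path_lift_unique L'c l'c L'P l'P); rewrite L'0.
Unshelve. all: by end_near. Qed.

End Lifting.

(** * Integrals and partitions *)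

Section IntegralComparison.
Context d (T : measurableType d) (R : realType) (mu : {measure set T -> \bar R}).
Local Open Scope ereal_scope.
Import HBNNSimple.

(** The integral of a nonnegative function is the supremum over the simple
    functions below it, and these keep their integral when they are set to zero
    on a null set. *)
Lemma le_integral_off_null (D N : set T) (F G : T -> \bar R) :
  measurable N -> mu N = 0 ->
  (forall x, D x -> 0 <= F x) -> (forall x, D x -> 0 <= G x) ->
  (forall x, D x -> ~ N x -> F x <= G x) ->
  \int[mu]_(x in D) F x <= \int[mu]_(x in D) G x.
Proof.
move=> mN N0 F0 G0 FG; rewrite !ge0_integralE//.
apply: ub_ereal_sup => _ [h hF <-].
have mNC : measurable (setT `\` N) by exact: measurableD.
have -> : sintegral mu h = sintegral mu (proj_nnsfun h mNC).
  rewrite -[LHS]integralT_nnsfun (@ge0_negligible_integral _ _ _ mu setT N)//.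
  - by rewrite integral_nnsfun// mrestrict.
  - by apply/measurable_realfun.measurable_EFinP; exact: measurable_funTS.
  - by move=> x _; rewrite lee_fin fun_ge0.
apply: ereal_sup_ubound; exists (proj_nnsfun h mNC) => //= x.
rewrite measurable_realfun.mindicE; have [Nx|Nx] := pselect (N x).
  rewrite memNset; last by move=> [].
  by rewrite mulr0; apply: erestrict_ge0.
rewrite mem_set// mulr1; apply: le_trans (hF x) _.
rewrite /patch; case: ifPn => //.
by rewrite inE => Dx; exact: FG.
Qed.

End IntegralComparison.

Section Partition.
Context {R : realType}.

Lemma itv_partition_locate (a b t : R) (s : seq R) : itv_partition a b s ->
  a <= t <= b -> t \notin a :: s ->
  exists2 k, (k < size s)%N & nth b (a :: s) k < t < nth b (a :: s) k.+1.
Proof.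
elim: s a => [|x s IHs] a.
  move=> /itv_partition_nil -> /andP[h1 h2].
  have -> : t = b by apply/le_anti; rewrite h1 h2.
  by rewrite mem_head.
move=> abs; have xbs := itv_partition_cons abs.
rewrite in_cons negb_or => /andP[at_ tb] /andP[ta ts].
have at' : a < t by rewrite lt_neqAle eq_sym ta.
have [tx|xt] := ltP t x; first by exists 0%N => //=; rewrite at' tx.
have [|k ks kP] := IHs x xbs _ ts; first by rewrite xt.
by exists k.+1.
Qed.

End Partition.

(** * Holomorphic maps contract the canonical metrics infinitesimally *)

Section Charts.
Context {R : realType}.
Local Notation C := (Cplx R).

Lemma near_chart_dom (M : riemann_surface R) (phi : @chart R M) (p : M) :
  chart_dom phi p -> \forall q \near p, chart_dom phi q.
Proof. by move=> pP; apply: open_nbhs_nbhs; split=> //; exact: chart_dom_open. Qed.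

Lemma chart_continuous (M : riemann_surface R) (phi : @chart R M) (p : M) :
  chart_dom phi p -> {for p, continuous (phi : M -> C)}.
Proof.
move=> pP; have := chart_map_continuous phi.
rewrite continuous_open_subspace; last exact: chart_dom_open.
by apply; rewrite inE.
Qed.

Lemma near_chart_img (M : riemann_surface R) (phi : @chart R M) (p : M) :
  chart_dom phi p -> \forall w \near phi p, chart_img phi w.
Proof.
move=> pP; apply: open_nbhs_nbhs; split; first exact: chart_img_open.
by exists p.
Qed.

Lemma chart_inv_continuous_at (M : riemann_surface R) (phi : @chart R M) (p : M) :
  chart_dom phi p -> {for phi p, continuous (chart_inv phi)}.
Proof.
move=> pP; have := chart_inv_continuous phi.
rewrite continuous_open_subspace; last exact: chart_img_open.
by apply; rewrite inE; exists p.
Qed.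

Lemma chart_atP (M : riemann_surface R) (p : M) :
  atlas (chart_at p) /\ chart_dom (chart_at p) p.
Proof. by rewrite /chart_at; case: cid2. Qed.

Lemma disc_covering_continuous (M : riemann_surface R) (pi : C -> M) z :
  holomorphic_disc_covering pi -> unit_disc z -> {for z, continuous pi}.
Proof.
move=> [[pc _] _] zD; move: pc.
rewrite continuous_open_subspace; last exact: unit_disc_open.
by apply; rewrite inE.
Qed.

Lemma disc_covering_has_deriv (M : riemann_surface R) (pi : C -> M) phi z :
  holomorphic_disc_covering pi -> atlas phi -> unit_disc z ->
  chart_dom phi (pi z) ->
  has_deriv (phi \o pi : C -> C) z (derive1 (phi \o pi : C -> C) z).
Proof.
move=> [[_ hol] _] aphi zD pz; apply: derivable_has_deriv.
by apply: hol.
Qed.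

Context {X Y : riemann_surface R} (f : holomorphic_map X Y).

Definition local_rep (phi : @chart R X) (psi : @chart R Y) : C -> C :=
  psi \o f \o chart_inv phi.

Lemma local_rep_has_deriv phi psi x : atlas phi -> atlas psi ->
  chart_dom phi x -> chart_dom psi (f x) ->
  has_deriv (local_rep phi psi) (phi x) (derive1 (local_rep phi psi) (phi x)).
Proof.
move=> aphi apsi xP fxP; apply: derivable_has_deriv.
by apply: (@hol_charts _ _ _ f phi psi aphi apsi); exists x.
Qed.

Lemma local_rep_near phi psi x : atlas phi -> atlas psi ->
  chart_dom phi x -> chart_dom psi (f x) ->
  \forall w \near phi x, exists d, has_deriv (local_rep phi psi) w d.
Proof.
move=> aphi apsi xP fxP.
have ic := chart_inv_continuous_at xP.
have fic : {for phi x, continuous (f \o chart_inv phi)}.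
  by apply: continuous_comp ic _; rewrite chart_mapK//; exact: hol_continuous.
have n1 := near_chart_img xP.
have n2 : \forall w \near phi x, chart_dom psi (f (chart_inv phi w)).
  by apply: fic; rewrite /= chart_mapK//; exact: near_chart_dom.
near=> w.
have [q qP qw] : chart_img phi w by near: w.
exists (derive1 (local_rep phi psi) w); rewrite -qw.
apply: local_rep_has_deriv => //; rewrite -(chart_mapK qP) qw; near: w.
exact: n2.
Unshelve. all: by end_near. Qed.

End Charts.

(** [A], [a], [b] are the moduli of the derivatives of the map and of the two
    coverings, so that [A * a / b] belongs to the lift, and [u], [v] are the
    values of [1 - |z| ^ 2] at a point of the disc and at its image. *)
Lemma conformal_factor_le (R : realFieldType) (A a b u v hX hY : R) :
  0 <= A -> 0 <= a -> 0 < b -> 0 < u -> 0 < v -> A * a / b * u <= v ->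
  4 * u ^- 2 = hX * a ^+ 2 -> 4 * v ^- 2 = hY * b ^+ 2 -> hY * A ^+ 2 <= hX.
Proof.
move=> A0 a0 b0 u0 v0 SP EX EY.
have u20 : 4 * u ^- 2 > 0 by rewrite mulr_gt0// invr_gt0 exprn_gt0.
have a2 : 0 < a ^+ 2.
  rewrite exprn_gt0// lt_neqAle a0 andbT eq_sym; apply/eqP => a00.
  by move: u20; rewrite EX a00 expr0n mulr0 ltxx.
rewrite -(ler_pM2r a2) -EX.
have b20 : 0 < b ^+ 2 by rewrite exprn_gt0.
have -> : hY = 4 * v ^- 2 / b ^+ 2 by rewrite EY mulfK// gt_eqF.
have Aab : (A * a / b * u) ^+ 2 <= v ^+ 2.
  rewrite ler_pXn2r ?nnegrE//; last exact: ltW.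
  by rewrite mulr_ge0 ?(ltW u0)// divr_ge0 ?mulr_ge0// ltW.
have -> : 4 * v ^- 2 / b ^+ 2 * A ^+ 2 * a ^+ 2 =
    4 * u ^- 2 * (v ^- 2 * (A * a / b * u) ^+ 2).
  by field; rewrite !gt_eqF.
rewrite ler_piMr; [by []|exact: ltW|].
by rewrite mulrC ler_pdivrMr ?mul1r// exprn_gt0.
Qed.

Section Contraction.
Context {R : realType}.
Local Notation C := (Cplx R).
Context {X Y : riemann_surface R} (piX : C -> X) (piY : C -> Y)
  (gX : hermitian_metric X) (gY : hermitian_metric Y) (f : holomorphic_map X Y).
Hypotheses (piX_cov : holomorphic_disc_covering piX)
  (piY_cov : holomorphic_disc_covering piY)
  (gX_canonical : disc_local_isometry piX gX)
  (gY_canonical : disc_local_isometry piY gY).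

Lemma poincare_coef_gt0 (z : C) : unit_disc z -> 0 < poincare_coef z.
Proof.
move=> zD; rewrite /poincare_coef mulr_gt0// invr_gt0 exprn_gt0// subr_gt0.
by rewrite expr_lt1// cmod_ge0.
Qed.

(** The derivative of a lift [F] of [f], read off from the commuting square; the
    local isometry keeps the derivative of [piY] away from [0]. *)
Lemma lift_has_deriv (F : C -> C) (phi : @chart R X) (psi : @chart R Y) z :
  (forall w, unit_disc w ->
    [/\ unit_disc (F w), piY (F w) = f (piX w) & {for w, continuous F}]) ->
  unit_disc z -> atlas phi -> atlas psi ->
  chart_dom phi (piX z) -> chart_dom psi (f (piX z)) ->
  derive1 (psi \o piY : C -> C) (F z) != 0 /\
  has_deriv F z (derive1 (local_rep f phi psi) (phi (piX z)) *
    derive1 (phi \o piX : C -> C) z / derive1 (psi \o piY : C -> C) (F z)).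
Proof.
move=> FP zD aphi apsi phiz psiz; have [FzD FE Fc] := FP _ zD.
have psiF : chart_dom psi (piY (F z)) by rewrite FE.
have b0 : derive1 (psi \o piY : C -> C) (F z) != 0.
  apply/eqP => E; have := gY_canonical FzD apsi psiF.
  rewrite E cmod0 expr0n mulr0 => /eqP.
  by rewrite gt_eqF// poincare_coef_gt0.
split=> //; apply: (has_deriv_lift Fc _ b0).
  exact: disc_covering_has_deriv.
have dX := disc_covering_has_deriv piX_cov aphi zD phiz.
have dk := local_rep_has_deriv aphi apsi phiz psiz.
apply: has_deriv_near (has_deriv_comp dX dk).
have n1 : \forall w \near z, chart_dom phi (piX w).
  by apply: (disc_covering_continuous piX_cov zD); exact: near_chart_dom.
near=> w; have wD : unit_disc w by near: w; exact: near_unit_disc.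
have [_ FwE _] := FP _ wD.
by rewrite /local_rep /= FwE chart_mapK//; near: w.
Unshelve. all: by end_near. Qed.

(** Schwarz-Pick for a lift of [f \o piX], read through the local isometries. *)
Lemma metric_contraction (phi : @chart R X) (psi : @chart R Y) x :
  atlas phi -> atlas psi -> chart_dom phi x -> chart_dom psi (f x) ->
  hcoef gY psi (psi (f x)) * cmod (derive1 (local_rep f phi psi) (phi x)) ^+ 2 <=
  hcoef gX phi (phi x).
Proof.
move=> aphi apsi phix psix.
have [z zD zx] : (piX @` unit_disc) x by have [_ [_ -> _]] := piX_cov.
have [w0 w0D w0E] : (piY @` unit_disc) (f (piX 0)) by have [_ [_ -> _]] := piY_cov.
have fpc w : unit_disc w -> {for w, continuous (f \o piX)}.
  move=> wD; apply: continuous_comp; first exact: disc_covering_continuous.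
  exact: hol_continuous.
have [F FP] := lift_disc piY_cov.2 fpc w0D w0E.
rewrite -zx in phix psix *.
have [FzD FE _] := FP _ zD.
have [b0 Fd] := lift_has_deriv FP zD aphi apsi phix psix.
have psiF : chart_dom psi (piY (F z)) by rewrite FE.
have EX := gX_canonical zD aphi phix.
have EY := gY_canonical FzD apsi psiF.
have SP : cmod (derive1 (local_rep f phi psi) (phi (piX z)) *
    derive1 (phi \o piX : C -> C) z / derive1 (psi \o piY : C -> C) (F z)) *
    (1 - cmod z ^+ 2) <= 1 - cmod (F z) ^+ 2.
  apply: (schwarz_pick _ _ zD Fd) => w wD; first by have [] := FP _ wD.
  have [aphi' phi'w] := chart_atP (piX w).
  have [apsi' psi'w] := chart_atP (f (piX w)).
  by have [_ Fd'] := lift_has_deriv FP wD aphi' apsi' phi'w psi'w; eexists; exact: Fd'.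
rewrite !cmodM cmodV in SP; rewrite FE in EY.
apply: (conformal_factor_le _ _ _ _ _ SP EX EY); rewrite ?cmod_ge0 ?cmod_gt0//.
- by rewrite subr_gt0 expr_lt1// cmod_ge0.
- by rewrite subr_gt0 expr_lt1// cmod_ge0.
Qed.

End Contraction.

(** * Holomorphic maps decrease lengths and distances *)

Section Curves.
Context {R : realType}.
Local Notation C := (Cplx R).
Context {X Y : riemann_surface R} (f : holomorphic_map X Y).

Lemma near_local_rep (phi : @chart R X) (psi : @chart R Y) (gam : R -> X) (t : R) :
  {for t, continuous gam} -> chart_dom phi (gam t) ->
  \forall s \near t, psi (f (gam s)) = local_rep f phi psi (phi (gam s)).
Proof.
move=> gc gt; have n1 : \forall s \near t, chart_dom phi (gam s).
  by apply: gc; exact: near_chart_dom.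
by apply: filterS n1 => s sP; rewrite /local_rep/= chart_mapK.
Qed.

Lemma is_derive_local_rep (phi : @chart R X) (psi : @chart R Y) (gam : R -> X)
    (t dx dy : R) : atlas phi -> atlas psi ->
  {for t, continuous gam} -> chart_dom phi (gam t) -> chart_dom psi (f (gam t)) ->
  is_derive t 1 (fun s => complex.Re (phi (gam s))) dx ->
  is_derive t 1 (fun s => complex.Im (phi (gam s))) dy ->
  let d : C := derive1 (local_rep f phi psi) (phi (gam t)) * (dx +i* dy : C) in
  is_derive t 1 (fun s => complex.Re (psi (f (gam s)))) (complex.Re d) /\
  is_derive t 1 (fun s => complex.Im (psi (f (gam s)))) (complex.Im d).
Proof.
move=> aphi apsi gc phit psit dX dY d.
have n := near_local_rep psi gc phit.
have k := local_rep_has_deriv aphi apsi phit psit.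
have [h1 h2] := @is_derive_along_curve R _ (phi \o gam) t dx dy _ dX dY k.
split.
  apply: near_eq_is_derive h1; rewrite ?oner_neq0//.
  by apply: filterS n => s ->.
apply: near_eq_is_derive h2; rewrite ?oner_neq0//.
by apply: filterS n => s ->.
Qed.

(** In charts the velocity of [f \o gam] is that of [gam] times the complex
    derivative of [f], and the latter is continuous. *)
Lemma C1_on_comp (O : set R) (gam : R -> X) : open O -> C1_on O gam ->
  C1_on O (f \o gam).
Proof.
move=> Oo gC t Ot; have [gc _] := gC _ Ot.
have fgc : {for t, continuous (f \o gam)}.
  by apply: continuous_comp gc _; exact: hol_continuous.
split => // psi apsi psit x y.
have [aphi phit] := chart_atP (gam t); set phi := chart_at (gam t) in aphi phit.
pose x0 s := complex.Re (phi (gam s)); pose y0 s := complex.Im (phi (gam s)).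
have [_ /(_ phi aphi phit)[dx0 dy0 cx0 cy0]] := gC _ Ot.
pose d s : C := derive1 (local_rep f phi psi) (phi (gam s)) *
  (derive1 x0 s +i* derive1 y0 s : C).
have near_d : \forall s \near t,
    is_derive (s : R) 1 x (complex.Re (d s)) /\ is_derive (s : R) 1 y (complex.Im (d s)).
  have n1 : \forall s \near t, chart_dom phi (gam s).
    by apply: gc; exact: near_chart_dom.
  have n2 : \forall s \near t, chart_dom psi (f (gam s)).
    by apply: fgc; exact: near_chart_dom.
  have n3 : \forall s \near t, O s by exact: open_nbhs_nbhs.
  near=> s; have Os : O s by near: s.
  have phis : chart_dom phi (gam s) by near: s.
  have psis : chart_dom psi (f (gam s)) by near: s.
  have [gcs /(_ phi aphi phis)[dxs dys _ _]] := gC _ Os.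
  apply: (is_derive_local_rep aphi apsi gcs phis psis).
    exact: DeriveDef dxs (esym (derive1E _ _)).
  exact: DeriveDef dys (esym (derive1E _ _)).
have dc : {for t, continuous d}.
  have c1 : {for t, continuous (fun s => derive1 (local_rep f phi psi) (phi (gam s)))}.
    apply: (@continuous_comp _ _ _ (phi \o gam)).
      by apply: continuous_comp gc _; exact: chart_continuous.
    by apply: derive1_continuous; exact: local_rep_near.
  exact: contCM c1 (cont_complex cx0 cy0).
have [dx dy] := nbhs_singleton near_d.
split.
- by have [] := dx.
- by have [] := dy.
- apply: cont_near (cont_Re dc); apply: filterS near_d => s [[dxs <-] _].
  by rewrite derive1E.
- apply: cont_near (cont_Im dc); apply: filterS near_d => s [_ [dys <-]].
  by rewrite derive1E.
Unshelve. all: by end_near. Qed.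

Lemma piecewise_C1_comp (a b : R) (gam : R -> X) : piecewise_C1 a b gam ->
  piecewise_C1 a b (f \o gam).
Proof.
move=> [gc [s abs sP]]; split.
  apply: (@within_comp _ _ _ _ setT) gc _ _ => //.
  by apply: continuous_subspaceT; exact: hol_continuous.
exists s => // k ks; have [Op [dl [Oo IO dlC dlE]]] := sP k ks.
exists Op, (f \o dl); split => //; first exact: C1_on_comp.
by move=> t It /=; rewrite dlE.
Qed.

End Curves.

Section DistanceDecreasing.
Context {R : realType}.
Local Notation C := (Cplx R).
Context {X Y : riemann_surface R} (piX : C -> X) (piY : C -> Y)
  (gX : hermitian_metric X) (gY : hermitian_metric Y) (f : holomorphic_map X Y).
Hypotheses (piX_cov : holomorphic_disc_covering piX)
  (piY_cov : holomorphic_disc_covering piY)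
  (gX_canonical : disc_local_isometry piX gX)
  (gY_canonical : disc_local_isometry piY gY).

Lemma speed_contraction (O : set R) (dl gam : R -> X) (t : R) :
  C1_on O dl -> O t -> {near t, dl =1 gam} ->
  speed gY (f \o gam) t <= speed gX gam t.
Proof.
move=> dlC Ot dg; have [dlc dlP] := dlC _ Ot.
have dgt : dl t = gam t := nbhs_singleton dg.
have gc : {for t, continuous gam} := cont_near dg dlc.
have [aphi phit] := chart_atP (gam t); have [apsi psit] := chart_atP (f (gam t)).
rewrite /speed /=.
set phi := chart_at (gam t) in aphi phit *.
set psi := chart_at (f (gam t)) in apsi psit *.
have [|dx dy _ _] := dlP phi aphi; first by rewrite dgt.
set x := fun s => complex.Re (phi (gam s)); set y := fun s => complex.Im (phi (gam s)).
have near_is_derive (u v : R -> R) : {near t, u =1 v} -> derivable u t 1 ->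
    is_derive t 1 v (derive1 v t).
  move=> uv du; have [dv vE] : is_derive t 1 v ('D_1 u t).
    by apply: near_eq_is_derive (DeriveDef du erefl); rewrite ?oner_neq0.
  by apply: DeriveDef => //; rewrite derive1E.
have dX : is_derive t 1 x (derive1 x t).
  by apply: near_is_derive dx; apply: filterS dg => s ->.
have dY : is_derive t 1 y (derive1 y t).
  by apply: near_is_derive dy; apply: filterS dg => s ->.
have [[_ h1] [_ h2]] := is_derive_local_rep aphi apsi gc phit psit dX dY.
rewrite !derive1E h1 h2 -!derive1E -cmodE cmodM mulrA.
rewrite [X in _ <= _ * X](_ : _ = cmod (derive1 x t +i* derive1 y t : C)); last first.
  by rewrite cmodE.
apply: ler_wpM2r; first exact: cmod_ge0.
rewrite -[X in _ * X](@ger0_norm _ (cmod _)) ?cmod_ge0//.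
rewrite -sqrtr_sqr -sqrtrM; last by apply/ltW/hcoef_gt0 => //; exists (f (gam t)).
by apply: ler_wsqrtr; exact: (metric_contraction piX_cov piY_cov).
Qed.

(** Speeds compare away from the partition points, which form a null set. *)
Lemma riemannian_length_contraction (gam : R -> X) : piecewise_C1 0 1 gam ->
  (riemannian_length gY 0 1 (f \o gam) <= riemannian_length gX 0 1 gam)%E.
Proof.
move=> [gc [s abs sP]].
have cN : countable [set` 0 :: s] by apply: finite_set_countable; exact: finite_seq.
rewrite /riemannian_length.
apply: (@le_integral_off_null _ _ R lebesgue_measure _ [set` 0 :: s]).
- exact: countable_measurable.
- exact: countable_lebesgue_measure0.
- by move=> t _; rewrite lee_fin mulr_ge0// sqrtr_ge0.
- by move=> t _; rewrite lee_fin mulr_ge0// sqrtr_ge0.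
move=> t; rewrite /= in_itv/= => t01 /negP tN; rewrite lee_fin.
have [k ks /andP[kt tk]] := itv_partition_locate abs t01 tN.
have [Op [dl [Oo IO dlC dlE]]] := sP k ks.
apply: (speed_contraction dlC (O := Op)).
  by apply: IO; rewrite /= in_itv/= !ltW.
have tI : t \in `]nth 1 (0 :: s) k, nth 1 (0 :: s) k.+1[ by rewrite in_itv/= kt.
apply: filterS (near_in_itvoo tI) => u; rewrite in_itv/= => /andP[ku uk].
by apply: dlE; rewrite in_itv/= !ltW.
Qed.

Lemma riemannian_distance_contraction (p q : X) :
  (riemannian_distance gY (f p) (f q) <= riemannian_distance gX p q)%E.
Proof.
apply: le_ereal_inf_tmp => _ [gam [gC g0 g1] <-].
apply: le_trans (riemannian_length_contraction gC).
apply: ereal_inf_lbound; exists (f \o gam) => //=.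
by split; [exact: piecewise_C1_comp|rewrite /= g0|rewrite /= g1].
Qed.

Lemma curve_length_contraction (a b : R) (alpha : R -> X) :
  (curve_length (riemannian_distance gY) a b (f \o alpha) <=
   curve_length (riemannian_distance gX) a b alpha)%E.
Proof.
apply: ub_ereal_sup => _ [s abs <-].
apply: (@le_trans _ _ (\sum_(k < size s)
    riemannian_distance gX (alpha (nth b (a :: s) k)) (alpha (nth b (a :: s) k.+1)))%E).
  by apply: lee_sum => k _; exact: riemannian_distance_contraction.
by apply: ereal_sup_ubound; exists s.
Qed.

End DistanceDecreasing.

(** * Free and based homotopies of loops *)

Section FreeHomotopy.
Context {R : realType}.

Lemma within_comp_total (S T U : topologicalType) (B : set T) (h : S -> T)
    (k : T -> U) :
  continuous h -> {within B, continuous k} -> (forall x, B (h x)) ->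
  continuous (k \o h).
Proof.
move=> hc /subspace_continuousP kc hB x.
move=> W nW.
have n1 : nbhs (h x) (fun y => B y -> W (k y)) := kc _ (hB x) _ nW.
have n2 : \forall y \near x, B (h y) -> W (k (h y)) := hc x _ n1.
rewrite -[_ _]/(\forall y \near x, W (k (h y))).
by apply: filterS n2 => y; apply.
Qed.

Definition free_homotopy (T : topologicalType) (a b : R) (alpha beta : R -> T) : Prop :=
  exists H : R * R -> T, homotopy_on `[a, b] alpha beta H /\
    forall s, 0 <= s <= 1 -> H (a, s) = H (b, s).

Context {T : topologicalType}.
Implicit Types (a b : R) (alpha beta : R -> T).

Lemma free_homotopy_sym a b alpha beta :
  free_homotopy a b alpha beta -> free_homotopy a b beta alpha.
Proof.
move=> [H [hH He]]; exists (rev_homotopy H); split; first exact: rev_homotopyP.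
by move=> s /andP[s0 s1]; apply: He; rewrite subr_ge0 s1 lerBlDr lerDl.
Qed.

Lemma free_homotopy_trans a b alpha beta gam :
  free_homotopy a b alpha beta -> free_homotopy a b beta gam ->
  free_homotopy a b alpha gam.
Proof.
move=> [H [hH He]] [K [hK Ke]]; exists (cat_homotopy H K); split.
  by apply: cat_homotopyP hH hK; exact: itv_closed.
move=> s /andP[s0 s1]; rewrite /cat_homotopy /=; case: (leP s 2^-1) => hs.
  by apply: He; apply/andP; split; lra.
by apply: Ke; apply/andP; split; lra.
Qed.

Lemma contractible_free_homotopy a b alpha beta :
  free_homotopy a b alpha beta -> contractible_loop a b beta ->
  contractible_loop a b alpha.
Proof. by move=> ab [p bp]; exists p; exact: free_homotopy_trans ab bp. Qed.

Lemma free_homotopy_comp (U : topologicalType) (k : T -> U) a b alpha beta :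
  continuous k -> free_homotopy a b alpha beta ->
  free_homotopy a b (k \o alpha) (k \o beta).
Proof.
move=> kc [H [[Hc H0 H1] He]]; exists (k \o H); split; last by move=> s /He/= ->.
split => [|t /H0/= ->|t /H1/= ->]//.
by apply: (@within_comp _ _ _ _ setT) => //; exact: continuous_subspaceT.
Qed.

Lemma contractible_comp (U : topologicalType) (k : T -> U) a b alpha :
  continuous k -> contractible_loop a b alpha -> contractible_loop a b (k \o alpha).
Proof. by move=> kc [p ap]; exists (k p); exact: free_homotopy_comp ap. Qed.

Lemma contractible_reparam (u : R -> R) a b a' b' alpha beta : continuous u ->
  (forall t, a' <= t <= b' -> a <= u t <= b) -> u a' = a -> u b' = b ->
  (forall t, a' <= t <= b' -> beta t = alpha (u t)) ->
  contractible_loop a b alpha -> contractible_loop a' b' beta.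
Proof.
move=> uc uab ua ub betaE [p [H [[Hc H0 H1] He]]].
have uI t : a' <= t <= b' -> `[a, b]%classic (u t).
  by move=> /uab; rewrite /= in_itv.
exists p, (fun z : R * R => H (u z.1, z.2)); split; last first.
  by move=> s s01 /=; rewrite ua ub He.
split=> [|t|t]; last 2 first.
- by rewrite /= in_itv/= => tI; rewrite H0 ?betaE//; exact: uI.
- by rewrite /= in_itv/= => tI; rewrite H1//; exact: uI.
apply: (@within_comp _ _ _ _ _ (fun z : R * R => (u z.1, z.2)) _ _ Hc).
  apply: continuous_subspaceT => z.
  have c1 : {for z, continuous (fun z : R * R => u z.1)}.
    by apply: (@continuous_comp _ _ _ fst u); [exact: cvg_fst|exact: uc].
  exact: (cont_pair c1 cvg_snd).
move=> [t s] [/= tI sI]; split => //=.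
by apply: uI; move: tI; rewrite /= in_itv.
Qed.

Lemma continuous_clamp_comp a b alpha : a <= b ->
  {within `[a, b], continuous alpha} -> continuous (alpha \o clamp a b).
Proof.
move=> ab ac; apply: within_comp_total ac _; first exact: continuous_clamp.
by move=> x; rewrite /= in_itv/= clamp_itv.
Qed.

Lemma homotopy_clamp (H : R * R -> T) :
  {within `[(0 : R), 1] `*` `[(0 : R), 1], continuous H} ->
  continuous (fun z : R * R => H (clamp 0 1 z.1, clamp 0 1 z.2)).
Proof.
move=> Hc.
apply: (@within_comp_total _ _ _ _ (fun z : R * R => (clamp 0 1 z.1, clamp 0 1 z.2)) _ _ Hc).
  move=> z.
  apply: (@cont_pair (R * R)%type R R (fun z : R * R => clamp 0 1 z.1) (fun z : R * R => clamp 0 1 z.2)).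
    by apply: (@continuous_comp _ _ _ fst (clamp 0 1)); [exact: cvg_fst|exact: continuous_clamp].
  by apply: (@continuous_comp _ _ _ snd (clamp 0 1)); [exact: cvg_snd|exact: continuous_clamp].
by move=> z; split; rewrite /= in_itv/= clamp_itv.
Qed.

(** Running along [beta] from [beta 1] to [alpha 0], around [alpha], and back:
    shrinking the tail [beta] is a free homotopy to [alpha]. *)
Lemma conjugate_loop (alpha beta : R -> T) : continuous alpha ->
  continuous beta -> alpha 0 = alpha 1 -> beta 0 = alpha 0 ->
  exists c : R -> T, [/\ continuous c, c 0 = beta 1, c 1 = beta 1 &
    free_homotopy 0 1 c alpha].
Proof.
move=> ac bc a01 b0.
pose K (z : R * R) : T := if z.1 <= 0 then beta ((1 - z.2) * (- z.1)) else
  if z.1 <= 1 then alpha z.1 else beta ((1 - z.2) * (z.1 - 1)).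
have fstc : continuous (fun z : R * R => z.1) by move=> z; exact: cvg_fst.
have sndc : continuous (fun z : R * R => z.2) by move=> z; exact: cvg_snd.
have scale (u : R * R -> R) : continuous u ->
    continuous (fun z : R * R => beta ((1 - z.2) * u z)).
  move=> uc z; apply: (@continuous_comp _ _ _ (fun z : R * R => (1 - z.2) * u z) beta);
    last exact: bc.
  apply: (@contM _ R (fun z : R * R => 1 - z.2) u); last exact: uc.
  by apply: (@contB _ R (fun=> 1) snd); [exact: cont_cst|exact: sndc].
have Kc : continuous K.
  apply: (@continuous_glue R _ _ fst 0) => //.
  - by apply: scale => z; apply: (@contN _ R fst); exact: fstc.
  - apply: (@continuous_glue R _ _ fst 1) => //.
    + by move=> z; apply: (@continuous_comp _ _ _ fst alpha); [exact: fstc|exact: ac].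
    + apply: scale => z; apply: (@contB _ R fst (fun=> 1)); first exact: fstc.
      exact: cont_cst.
    + by move=> z ->; rewrite subrr mulr0 b0 a01.
  - by move=> z ->; rewrite oppr0 mulr0 ler01 b0.
have lin (u v : R) : continuous (fun t : R => u * t + v).
  move=> t; apply: (@contD _ R (fun t => u * t) (fun=> v)); last exact: cont_cst.
  by apply: (@contM _ R (fun=> u) (fun t => t)); [exact: cont_cst|exact: cont_id].
have line (u v : R) : continuous (fun z : R * R => ((1 - z.2) * (u * z.1 + v)) + z.2 * z.1).
  move=> z; apply: (@contD _ R (fun z : R * R => (1 - z.2) * (u * z.1 + v)) (fun z : R * R => z.2 * z.1)).
    apply: (@contM _ R (fun z : R * R => 1 - z.2) (fun z : R * R => u * z.1 + v)).
      by apply: (@contB _ R (fun=> 1) snd); [exact: cont_cst|exact: sndc].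
    exact: (@continuous_comp _ _ _ fst (fun t : R => u * t + v) z (fstc z) (lin u v z.1)).
  exact: (@contM _ R snd fst z (sndc z) (fstc z)).
exists (fun t => K (3 * t - 1, 0)); split.
- move=> t; apply: (@continuous_comp _ _ _ (fun t : R => (3 * t - 1, 0) : R * R) K);
    last exact: Kc.
  apply: (@cont_pair R R R (fun t => 3 * t - 1) (fun=> 0)); first exact: lin.
  exact: cont_cst.
- rewrite /K/= mulr0 sub0r lerN10 opprK subr0 mulr1//.
- rewrite /K/= mulr1 subr0 mul1r.
  have -> : (3 - 1 <= 0 :> R) = false by apply/negbTE; rewrite -ltNge; lra.
  have -> : (3 - 1 <= 1 :> R) = false by apply/negbTE; rewrite -ltNge; lra.
  by congr beta; ring.
apply: (@free_homotopy_trans _ _ _ (fun t => alpha (clamp 0 1 (3 * t - 1)))).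
  exists (fun z : R * R => K (3 * z.1 - 1, z.2)); split; last first.
    move=> s _; rewrite /K/= mulr0 sub0r lerN10 opprK mulr1 mulr1.
    have -> : (3 - 1 <= 0 :> R) = false by apply/negbTE; rewrite -ltNge; lra.
    have -> : (3 - 1 <= 1 :> R) = false by apply/negbTE; rewrite -ltNge; lra.
    by congr beta; ring.
  split => // [|t _]; last first.
    rewrite /K/= subrr !mul0r b0.
    case: (leP (3 * t - 1) 0) => [h|/ltW h]; first by rewrite clamp_le// ler01.
    case: (leP (3 * t - 1) 1) => [h'|/ltW h']; first by rewrite clamp_id// h.
    by rewrite clamp_ge// ler01.
  apply: continuous_subspaceT => z.
  apply: (@continuous_comp _ _ _ (fun z : R * R => (3 * z.1 - 1, z.2) : R * R) K);
    last exact: Kc.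
  apply: (@cont_pair (R * R)%type R R (fun z : R * R => 3 * z.1 - 1) snd); last exact: sndc.
  apply: (@continuous_comp _ _ _ fst (fun t : R => 3 * t - 1)); first exact: fstc.
  exact: lin.
exists (fun z : R * R => alpha (clamp 0 1 ((1 - z.2) * (3 * z.1 - 1) + z.2 * z.1))).
split; last first.
  move=> s /andP[s0 s1] /=; rewrite clamp_le ?ler01//; last by nra.
  by rewrite clamp_ge ?ler01//; nra.
split=> [|t|t]; last 2 first.
- by rewrite /= subr0 mul1r mul0r addr0.
- by rewrite /= in_itv/= => t01; rewrite subrr mul0r mul1r add0r clamp_id.
apply: continuous_subspaceT => z.
have cc : continuous (alpha \o clamp 0 1).
  by move=> t; apply: continuous_comp; [exact: continuous_clamp|exact: ac].
exact: (continuous_comp (line 3 (- 1) z) (cc _)).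
Qed.

(** A based loop [c] with a free contraction [K] to a point is null rel base
    point: [c] is the bottom side of the square on which [K] lives, so it is
    homotopic to the path around the other three sides. There [K] is
    constant along the top and runs along the same path up and down the two
    vertical sides, so this path retracts to its start. *)
Lemma contractible_path_homotopic (x : T) (c e : loop x) :
  (forall t : R, 0 <= t <= 1 -> e t = x) ->
  contractible_loop 0 1 c -> path_homotopic c e.
Proof.
move=> eE [p [H [[Hc H0 H1] He]]].
pose K (z : R * R) := H (clamp 0 1 z.1, clamp 0 1 z.2).
have Kc : continuous K by exact: homotopy_clamp.
have in01 (t : R) : 0 <= t <= 1 -> `[(0 : R), 1]%classic t by rewrite /= in_itv.
have Kbot t : 0 <= t <= 1 -> K (t, 0) = c t.
  move=> t01; rewrite /K/= (clamp_id t01) (@clamp_id _ 0 1 0) ?lexx ?ler01//.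
  by rewrite H0//; exact: in01.
have Ktop t : K (t, 1) = p.
  rewrite /K/= (@clamp_id _ 0 1 1) ?lexx ?ler01//.
  by rewrite H1//; apply/in01/clamp_itv/ler01.
have Kside s : K (1, s) = K (0, s).
  rewrite /K/= (@clamp_id _ 0 1 1) ?(@clamp_id _ 0 1 0) ?lexx ?ler01//.
  by rewrite -He// clamp_itv// ler01.
have K00 : K (0, 0) = x by rewrite Kbot ?lexx ?ler01// loop0.
pose bx (t : R) := clamp 0 1 (3 * t - 1).
pose by_ (t : R) := Num.min 1 (Num.min (3 * t) (3 - 3 * t)).
have fstc : continuous (fun z : R * R => z.1) by move=> z; exact: cvg_fst.
have sndc : continuous (fun z : R * R => z.2) by move=> z; exact: cvg_snd.
have mulc (u : R) : continuous (fun t : R => u * t).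
  move=> t; apply: (@contM _ R (fun=> u) (fun t => t)); first exact: cont_cst.
  exact: cont_id.
have bxc : continuous bx.
  move=> t; apply: (@continuous_comp _ _ _ (fun t : R => 3 * t - 1) (clamp 0 1));
    last exact: continuous_clamp.
  by apply: (@contB R R (fun t : R => 3 * t) (fun=> 1)); [exact: mulc|exact: cont_cst].
have byc : continuous by_.
  move=> t; apply: (@continuous_min R R (fun=> 1) (fun t : R => Num.min (3 * t) (3 - 3 * t))).
    exact: cont_cst.
  apply: (@continuous_min R R (fun t : R => 3 * t) (fun t : R => 3 - 3 * t)).
    exact: mulc.
  by apply: (@contB R R (fun=> 3) (fun t : R => 3 * t)); [exact: cont_cst|exact: mulc].
have by0 : by_ 0 = 0.
  by rewrite /by_ mulr0 subr0 (@min_l _ _ 0 3)// ?min_r// ler01.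
have by1 : by_ 1 = 0.
  by rewrite /by_ mulr1 subrr (@min_r _ _ 3 0)// min_r// ler01.
have bx0 : bx 0 = 0 by rewrite /bx mulr0 sub0r clamp_le ?ler01// lerN10.
have bx1 : bx 1 = 1.
  by rewrite /bx clamp_ge ?ler01//; lra.
have Kb t : K (bx t, by_ t) = K (0, by_ t).
  rewrite /bx; have [h|h] := leP (3 * t - 1) 0; first by rewrite clamp_le// ler01.
  have [h'|h'] := leP 1 (3 * t - 1); first by rewrite clamp_ge ?ler01// Kside.
  have -> : by_ t = 1.
    by rewrite /by_ min_l// le_min; apply/andP; split; lra.
  by rewrite !Ktop.
have Kbyc : {within `[(0 : R), 1], continuous (fun t => K (0, by_ t))}.
  apply: continuous_subspaceT => t.
  apply: (@continuous_comp _ _ _ (fun t : R => (0, by_ t) : R * R) K); last exact: Kc.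
  apply: (@cont_pair R R R (fun=> 0) by_); first exact: cont_cst.
  exact: byc.
have K0 : K (0, by_ 0) = x by rewrite by0.
have K1 : K (0, by_ 1) = x by rewrite by1.
pose c1 : loop x := Loop Kbyc K0 K1.
apply: (@path_homotopic_trans _ _ _ _ c1).
  exists (fun z : R * R => K ((1 - z.2) * z.1 + z.2 * bx z.1, z.2 * by_ z.1)); split; last first.
    move=> s _; rewrite /= bx0 by0 bx1 by1 !mulr0 addr0; split => //.
    by rewrite !mulr1 subrK Kside.
  split=> [|t|t _]; last 2 first.
  - rewrite /= in_itv/= => t01.
    by rewrite subr0 mul1r !mul0r addr0 Kbot.
  - by rewrite /= subrr mul0r !mul1r add0r Kb.
  apply: continuous_subspaceT => z.
  apply: (@continuous_comp _ _ _ (fun z : R * R =>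
    ((1 - z.2) * z.1 + z.2 * bx z.1, z.2 * by_ z.1) : R * R) K); last exact: Kc.
  apply: (@cont_pair (R * R)%type R R (fun z : R * R => (1 - z.2) * z.1 + z.2 * bx z.1)
    (fun z : R * R => z.2 * by_ z.1)); last first.
    apply: (@contM _ R snd (fun z : R * R => by_ z.1)); first exact: sndc.
    exact: (@continuous_comp _ _ _ fst by_ z (fstc z) (byc z.1)).
  apply: (@contD _ R (fun z : R * R => (1 - z.2) * z.1) (fun z : R * R => z.2 * bx z.1)).
    apply: (@contM _ R (fun z : R * R => 1 - z.2) fst); last exact: fstc.
    by apply: (@contB _ R (fun=> 1) snd); [exact: cont_cst|exact: sndc].
  apply: (@contM _ R snd (fun z : R * R => bx z.1)); first exact: sndc.
  exact: (@continuous_comp _ _ _ fst bx z (fstc z) (bxc z.1)).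
exists (fun z : R * R => K (0, (1 - z.2) * by_ z.1)); split; last first.
  by move=> s _; rewrite /= by0 by1 !mulr0.
split=> [|t _|t].
- apply: continuous_subspaceT => z.
  apply: (@continuous_comp _ _ _ (fun z : R * R =>
    (0, (1 - z.2) * by_ z.1) : R * R) K); last exact: Kc.
  apply: (@cont_pair (R * R)%type R R (fun=> 0) (fun z : R * R => (1 - z.2) * by_ z.1)).
    exact: cont_cst.
  apply: (@contM _ R (fun z : R * R => 1 - z.2) (fun z : R * R => by_ z.1)).
    by apply: (@contB _ R (fun=> 1) snd); [exact: cont_cst|exact: sndc].
  exact: (@continuous_comp _ _ _ fst by_ z (fstc z) (byc z.1)).
- by rewrite /= subr0 mul1r.
- by rewrite /= in_itv/= => t01; rewrite subrr mul0r K00 eE.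
Qed.

End FreeHomotopy.

(** * Loops in covered surfaces and the theorem *)

Section Loops.
Context {R : realType}.
Local Notation C := (Cplx R).

Lemma disc_covering_path_connected (M : riemann_surface R) (pi : C -> M) (x y : M) :
  holomorphic_disc_covering pi ->
  exists beta : R -> M, [/\ continuous beta, beta 0 = x & beta 1 = y].
Proof.
move=> pi_cov; have [_ [_ piT _]] := pi_cov.
have [z zD <-] : (pi @` unit_disc) x by rewrite piT.
have [w wD <-] : (pi @` unit_disc) y by rewrite piT.
pose seg (t : R) : C :=
  ((1 - clamp 0 1 t)%:C : C) * z + ((clamp 0 1 t)%:C : C) * w.
have segD t : unit_disc (seg t).
  by apply: cmod_convex => //; exact/clamp_itv/ler01.
have segc : continuous seg.
  move=> t; have cc := @continuous_clamp R 0 1 t.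
  have c1 : {for t, continuous (fun t : R => ((1 - clamp 0 1 t)%:C : C))}.
    apply: cont_of_real; apply: (@contB R R (fun=> 1) (clamp 0 1)) cc.
    exact: cont_cst.
  have c2 : {for t, continuous (fun t : R => ((clamp 0 1 t)%:C : C))}.
    exact: cont_of_real.
  have zc := @cont_cst R C z t; have wc := @cont_cst R C w t.
  exact: (@contD _ R[i] _ _ _ (contCM c1 zc) (contCM c2 wc)).
exists (pi \o seg); split.
- move=> t; apply: (continuous_comp (segc t)).
  by apply: disc_covering_continuous.
- by rewrite /seg /= clamp_id ?lexx ?ler01// subr0 mul1r mul0r addr0.
- by rewrite /seg /= clamp_id ?lexx ?ler01// subrr mul0r mul1r add0r.
Qed.

Definition unit_param (T : Type) (a b : R) (alpha : R -> T) (t : R) : T :=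
  alpha (clamp a b (a + (b - a) * t)).

Lemma affine_continuous (u v : R) : continuous (fun t : R => u + v * t).
Proof.
move=> t; apply: (@contD R R (fun=> u) (fun t : R => v * t)); first exact: cont_cst.
by apply: (@contM R R (fun=> v) (fun t : R => t)); [exact: cont_cst|exact: cont_id].
Qed.

Lemma unit_param_continuous (T : topologicalType) (a b : R) (alpha : R -> T) :
  a < b -> {within `[a, b], continuous alpha} ->
  continuous (unit_param a b alpha).
Proof.
move=> ab ac t.
have cc := continuous_clamp_comp (ltW ab) ac.
exact: (continuous_comp (@affine_continuous a (b - a) t) (cc _)).
Qed.

Lemma unit_param_contractible (T : topologicalType) (a b : R) (alpha : R -> T) :
  a < b ->
  contractible_loop 0 1 (unit_param a b alpha) <-> contractible_loop a b alpha.
Proof.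
move=> ab; have ba : 0 < b - a by rewrite subr_gt0.
split.
  apply: (@contractible_reparam _ _ (fun t => - a / (b - a) + (b - a)^-1 * t)).
  - exact: affine_continuous.
  - move=> t /andP[at_ tb].
    have -> : - a / (b - a) + (b - a)^-1 * t = (t - a) / (b - a).
      by field; rewrite gt_eqF.
    apply/andP; split; first by rewrite divr_ge0 ?(ltW ba)// subr_ge0.
    by rewrite ler_pdivrMr// mul1r lerD2r.
  - by field; rewrite gt_eqF.
  - by field; rewrite gt_eqF.
  - move=> t tI; rewrite /unit_param; congr alpha.
    have -> : a + (b - a) * (- a / (b - a) + (b - a)^-1 * t) = t.
      by field; rewrite gt_eqF.
    by rewrite clamp_id.
have inI t : 0 <= t <= 1 -> a <= a + (b - a) * t <= b.
  move=> /andP[t0 t1]; rewrite lerDl mulr_ge0 ?(ltW ba)//=.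
  by rewrite -lerBrDl ler_piMr// ltW.
apply: (@contractible_reparam _ _ (fun t => a + (b - a) * t)).
- exact: affine_continuous.
- exact: inI.
- by rewrite mulr0 addr0.
- by rewrite mulr1 subrKC.
- by move=> t t01; rewrite /unit_param clamp_id// inI.
Qed.

End Loops.

Section NotInjective.
Context {R : realType} {X Y : topologicalType} (f : X -> Y) (fc : continuous f).

(** Moved to the base point [x] along [beta], [alpha] becomes a nontrivial
    element of the kernel. *)
Lemma pi1_map_not_injective (alpha beta : R -> X) (x : X) :
  continuous alpha -> alpha 0 = alpha 1 ->
  continuous beta -> beta 0 = alpha 0 -> beta 1 = x ->
  ~ contractible_loop 0 1 alpha -> contractible_loop 0 1 (f \o alpha) ->
  ~ injective (pi1_map R fc x).
Proof.
move=> ac a01 bc b0 b1 nca cfa inj.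
have [c [cc c0 c1 ca]] := conjugate_loop ac bc a01 b0.
rewrite b1 in c0 c1.
pose cl : loop x := Loop (continuous_subspaceT cc) c0 c1.
have e_cont : {within `[(0 : R), 1], continuous (fun=> x)}.
  by apply: continuous_subspaceT; exact: cst_continuous.
pose e : loop x := Loop e_cont erefl erefl.
have fcl : path_homotopic (loop_comp fc cl) (loop_comp fc e).
  apply: contractible_path_homotopic => //.
  exact: contractible_free_homotopy (free_homotopy_comp fc ca) cfa.
have /pi1P[H [hH He]] : \pi_(pi1 R x)%qT cl = \pi_(pi1 R x)%qT e.
  by apply: inj; rewrite !pi1_mapE; exact/pi1P.
apply: nca; apply: contractible_free_homotopy (free_homotopy_sym ca) _.
by exists x, H; split => // s /He[-> ->].
Qed.

(** If [g] is a homotopy inverse, [alpha] is freely homotopic to the image under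
    [g] of the contractible loop [f \o alpha]. *)
Lemma homotopy_equivalence_contractible (alpha : R -> X) : continuous alpha ->
  alpha 0 = alpha 1 -> homotopy_equivalence (R := R) f ->
  contractible_loop 0 1 (f \o alpha) -> contractible_loop 0 1 alpha.
Proof.
move=> ac a01 [_ [g [gc [H [Hc H0 H1]] _]]] cfa.
apply: contractible_free_homotopy (contractible_comp gc cfa).
apply: free_homotopy_sym; exists (fun z => H (alpha z.1, z.2)); split; last first.
  by move=> s _; rewrite a01.
split => [|t _|t _]; rewrite ?H0 ?H1//.
apply: (@within_comp _ _ _ _ _ (fun z : R * R => (alpha z.1, z.2)) _ _ Hc).
  apply: continuous_subspaceT => z.
  have c1 : {for z, continuous (fun z : R * R => alpha z.1)}.
    by apply: (@continuous_comp _ _ _ fst alpha); [exact: cvg_fst|exact: ac].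
  exact: (cont_pair c1 cvg_snd).
by move=> [t s] [].
Qed.

End NotInjective.

Theorem theorem3p4 (R : realType) (X Y : riemann_surface R)
    (piX : Cplx R -> X) (piX_cov : holomorphic_disc_covering piX)
    (piY : Cplx R -> Y) (piY_cov : holomorphic_disc_covering piY)
    (gX : hermitian_metric X) (gX_canonical : disc_local_isometry piX gX)
    (gY : hermitian_metric Y) (gY_canonical : disc_local_isometry piY gY)
    (ell1_lt : (ell1 (riemannian_distance gX)
                  < ell1 (riemannian_distance gY))%E)
    (f : holomorphic_map X Y) :
  (forall x : X, ~ injective (pi1_map R (hol_continuous f) x)) /\
  ~ homotopy_equivalence (R := R) f.
Proof.
have [_ [a [b [alpha [ab [ac aab] nca afin ->]]]] lt] := ereal_inf_lt ell1_lt.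
have fc := hol_continuous f.
have cfa : contractible_loop a b (f \o alpha).
  apply: contrapT => ncfa.
  have shorter := curve_length_contraction f piX_cov piY_cov gX_canonical gY_canonical a b alpha.
  move: lt; apply/negP; rewrite -leNgt; apply: (le_trans _ shorter).
  apply: ereal_inf_lbound; exists a, b, (f \o alpha); split => //.
    split; last by rewrite /= aab.
    apply: (@within_comp _ _ _ _ setT) ac _ _ => //.
    exact: continuous_subspaceT.
  exact: le_lt_trans shorter afin.
pose alpha1 := unit_param a b alpha.
have a1c : continuous alpha1 by exact: unit_param_continuous.
have a1loop : alpha1 0 = alpha1 1.
  rewrite /alpha1 /unit_param mulr0 addr0 mulr1 subrKC.
  by rewrite !clamp_id ?lexx ?(ltW ab).
have nca1 : ~ contractible_loop 0 1 alpha1 by move/(unit_param_contractible _ ab).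
have cfa1 : contractible_loop 0 1 (f \o alpha1).
  exact/(unit_param_contractible (f \o alpha) ab).
split=> [x|he].
  have [beta [bc b0 b1]] := disc_covering_path_connected (alpha1 0) x piX_cov.
  exact: pi1_map_not_injective a1c a1loop bc b0 b1 nca1 cfa1.
exact/nca1/(homotopy_equivalence_contractible a1c a1loop he).
Qed.
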